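(* Let $X$ be a real Banach space with the Radon-Nikod\'ym property. Then the set of norm attaining seminorms is Lipschitz-norm dense in $\mathrm{Sem}(X)$; that is, for every $p\in\mathrm{Sem}(X)$ and every $\varepsilon>0$ there is a norm attaining seminorm $q\in\mathrm{Sem}(X)$ with $\|p-q\|_{\mathrm{Lip}}<\varepsilon$.
   Context: Banach spaces are real and $X\neq\{0\}$; $S_X$ is the unit sphere of $X$. $\mathrm{Sem}(X)$ is the set of all continuous seminorms on $X$. For a Lipschitz function $f:X\to\mathbb{R}$ with $f(0)=0$, $\|f\|_{\mathrm{Lip}}=\sup\left\{\frac{|f(x)-f(y)|}{\|x-y\|}:x,y\in X,\ x\neq y\right\}$. Every $p\in\mathrm{Sem}(X)$ is Lipschitz, and its norm $\|p\|$ is $\|p\|_{\mathrm{Lip}}=\sup_{z\in S_X}p(z)$. A seminorm $p\in\mathrm{Sem}(X)$ is norm attaining if there is $z\in S_X$ with $p(z)=\|p\|$. *)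

(* Defs.v *)
From HB Require Import structures.
From mathcomp Require Import all_boot all_order all_algebra.
From mathcomp Require Import all_classical all_reals all_analysis.

Set Implicit Arguments.
Unset Strict Implicit.
Unset Printing Implicit Defensive.
Import Order.TTheory GRing.Theory Num.Theory.
Import numFieldNormedType.Exports.
Local Open Scope classical_set_scope.
Local Open Scope ring_scope.

(** * Bochner integral

    The library only integrates functions with values in [\bar R], so the
    Bochner integral of a vector-valued function over a finite measure space
    is set up as in Diestel and Uhl, Vector Measures. *)

Section bochner.
Context (R : realType) (X : normedModType R) (d : measure_display)
  (T : measurableType d) (mu : {finite_measure set T -> \bar R}).

Definition simple_fun (s : T -> X) : Prop :=
  finite_set (range s) /\ forall x : X, measurable (s @^-1` [set x]).

(* [mu] is finite, so [fine] loses nothing. *)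
Definition simple_integral (s : T -> X) (E : set T) : X :=
  \sum_(x \in range s) fine (mu (E `&` s @^-1` [set x])) *: x.

Definition strongly_measurable (g : T -> X) : Prop :=
  exists s : nat -> T -> X, (forall n, simple_fun (s n)) /\
    {ae mu, forall t, s n t @[n --> \oo] --> g t}.

(* [v] is the Bochner integral of [g] over [E]; in particular [g] is Bochner
   integrable on the whole space. *)
Definition is_bochner_integral (g : T -> X) (E : set T) (v : X) : Prop :=
  strongly_measurable g /\
  exists s : nat -> T -> X,
    [/\ forall n, simple_fun (s n),
        (\int[mu]_t `|g t - s n t|%:E)%E @[n --> \oo] --> 0%E &
        simple_integral (s n) E @[n --> \oo] --> v].

End bochner.

(** * Vector measures and the Radon-Nikodym property *)

Section vector_measure.
Context (R : realType) (X : normedModType R) (d : measure_display)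
  (T : measurableType d).

(* The values of [G] on non-measurable sets are irrelevant. The constant
   family [set0] shows that [G set0 = 0]. *)
Definition vector_measure (G : set T -> X) : Prop :=
  forall F : nat -> set T, (forall n, measurable (F n)) -> trivIset setT F ->
    \sum_(0 <= i < n) G (F i) @[n --> \oo] --> G (\bigcup_n F n).

Definition vm_variation (G : set T -> X) (A : set T) : \bar R :=
  ereal_sup [set v | exists (n : nat) (F : 'I_n -> set T),
    [/\ forall i, measurable (F i), trivIset setT F, \bigcup_i F i = A &
        v = (\sum_(i < n) `|G (F i)|)%:E]].

Definition vm_bounded_variation (G : set T -> X) : Prop :=
  (vm_variation G setT < +oo)%E.

Definition vm_continuous (mu : {finite_measure set T -> \bar R})
    (G : set T -> X) : Prop :=
  forall A, measurable A -> mu A = 0%E -> G A = 0.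

End vector_measure.

Definition radon_nikodym_property (R : realType) (X : normedModType R) : Prop :=
  forall (d : measure_display) (T : measurableType d)
         (mu : {finite_measure set T -> \bar R}) (G : set T -> X),
    vector_measure G -> vm_bounded_variation G -> vm_continuous mu G ->
    exists g : T -> X,
      forall E, measurable E -> is_bochner_integral mu g E (G E).

(** * Continuous seminorms *)

Section seminorm.
Context (R : realType) (X : normedModType R).

Definition seminorm (p : X -> R) : Prop :=
  (forall x y, p (x + y) <= p x + p y) /\
  (forall (a : R) x, p (a *: x) = `|a| * p x).

Definition Sem : set (X -> R) := [set p | seminorm p /\ continuous p].

(* Extended-real valued, so that a non-Lipschitz function gets [+oo]. *)
Definition lip_norm (f : X -> R) : \bar R :=
  ereal_sup [set r | exists x y : X,
    x != y /\ r = (`|f x - f y| / `|x - y|)%:E].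

Definition norm_attaining (p : X -> R) : Prop :=
  exists z : X, `|z| = 1 /\ (p z)%:E = lip_norm p.

End seminorm.

(* Main.v *)
(** A seminorm [p] is perturbed by [|y|] for a small linear functional [y]: if
    [p + y] has a maximum over the unit ball, then, [p] being even, so has
    [p + |y|], and the seminorm [p + |y|] attains its norm.

    By completeness, a [y] with this property is the sum of a rapidly converging
    series of functionals if, for every [d > 0], any function [f] bounded on the
    ball becomes, after adding a small functional, larger at some point [c] than
    on the part of the ball outside the ball of radius [d] around [c], with a
    positive gap.  Suppose that this fails for [f] and functionals of norm at
    most [e].  By the Mazur-Orlicz theorem, every [x] in the ball is then, up to
    an error, an average of points [z] of the ball at distance at least [d] from
    [x], and [e] times the error is at most the gain of the average of the [f z]
    over [f x], plus an arbitrarily small constant.  Iterating gives a process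
    in the ball with all increments at least [d] whose conditional mean
    increments have a finite sum of norms, because [f] is bounded: a bounded
    quasi-martingale.

    Integrating the process over a set and passing to the limit defines a
    vector measure [G] on [0, 1), which has a Bochner density by the
    Radon-Nikodym property.  A simple function close to this density is nearly
    constant on most cells of the process, so the averages of [G] over a cell
    and over its children are close to each other; they are also close to the
    values of the process, so its increments cannot all be at least [d]. *)

Require Import Defs.
From HB Require Import structures.
From mathcomp Require Import all_boot all_order all_algebra.
From mathcomp Require Import all_classical all_reals all_analysis.
From mathcomp Require Import measurable_realfun ring lra.
Import Order.TTheory GRing.Theory Num.Theory.
Import numFieldNormedType.Exports.
Local Open Scope classical_set_scope.
Local Open Scope ring_scope.
Set Implicit Arguments.
Unset Strict Implicit.
Unset Printing Implicit Defensive.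

(** * Measures and Dynkin systems *)

Section fine_measure.
Context {R : realType} {d : measure_display} {T : measurableType d}
  (mu : {finite_measure set T -> \bar R}).
Implicit Types A B E : set T.

Lemma fine_measure_ge0 A : 0 <= fine (mu A).
Proof. exact: fine_ge0. Qed.

Lemma fine_measureK A : measurable A -> (fine (mu A))%:E = mu A.
Proof. by move=> mA; rewrite fineK// fin_num_measure. Qed.

Lemma fine_measureU A B : measurable A -> measurable B -> A `&` B = set0 ->
  fine (mu (A `|` B)) = fine (mu A) + fine (mu B).
Proof.
move=> mA mB AB; rewrite measureU// fineD// fin_num_measure//.
Qed.

Lemma le_fine_measure A B : measurable A -> measurable B -> A `<=` B ->
  fine (mu A) <= fine (mu B).
Proof.
move=> mA mB AB; rewrite fine_le ?fin_num_measure//.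
by rewrite le_measure// inE.
Qed.

Lemma fine_measure_bigsetU (F : nat -> set T) n : (forall i, measurable (F i)) ->
  trivIset setT F ->
  fine (mu (\big[setU/set0]_(0 <= i < n) F i)) = \sum_(0 <= i < n) fine (mu (F i)).
Proof.
move=> mF tF; rewrite !big_mkord measure_bigsetU// sum_fine//.
by move=> i _; rewrite fin_num_measure.
Qed.

Lemma fine_measure_tail (F : nat -> set T) (eps : R) :
  (forall i, measurable (F i)) -> trivIset setT F -> 0 < eps ->
  exists n, fine (mu (\bigcup_i F i `\` \big[setU/set0]_(0 <= i < n) F i)) <= eps.
Proof.
move=> mF tF e0.
have mU : measurable (\bigcup_i F i) by exact: bigcup_measurable.
have mb n : measurable (\big[setU/set0]_(0 <= i < n) F i).
  by apply: bigsetU_measurable.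
have h := @measure_semi_sigma_additive _ _ _ mu F mF tF mU.
have : (fun n => fine (\sum_(0 <= i < n) mu (F i))%E) @ \oo --> fine (mu (\bigcup_i F i)).
  by apply: fine_cvg; rewrite fine_measureK.
move=> /cvgrPdist_le/(_ eps e0)[n _ /(_ n (leqnn n))] hn.
exists n; apply: le_trans hn; apply: le_trans (ler_norm _).
rewrite -sum_fine; last by move=> i _; rewrite fin_num_measure.
rewrite -fine_measure_bigsetU// lerBrDr.
rewrite -(fine_measureU (measurableD mU (mb n)) (mb n)); last first.
  by rewrite setDE -setIA setICl setI0.
apply: le_fine_measure => //; first by apply: measurableU => //; exact: measurableD.
by rewrite big_mkord => t [[]|St] //; exact: bigsetU_bigcup St.
Qed.


(** The sets with this smallness form a Dynkin system. In a countable disjoint union, finitely many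
    pieces are handled by subadditivity, and domination by [C] times the measure makes the tail
    small for all [i] at once. The filter is arbitrary so that both limits and Cauchy conditions are
    covered. *)
Lemma dynkin_small (I : Type) (Fl : set_system I) {FF : Filter Fl}
    (G : set (set T)) (L : I -> set T -> R) (C : R) :
  @measurable _ T = <<s G >> -> setI_closed G ->
  (forall i E, measurable E -> L i E <= C * fine (mu E)) ->
  (forall i A B, measurable A -> measurable B -> A `&` B = set0 ->
    L i (A `|` B) <= L i A + L i B) ->
  (forall i A, measurable A -> L i (~` A) <= L i setT + L i A) ->
  (forall A, A = setT \/ G A ->
     forall eps : R, 0 < eps -> \forall i \near Fl, L i A <= eps) ->
  forall E, measurable E ->
  forall eps : R, 0 < eps -> \forall i \near Fl, L i E <= eps.
Proof.
move=> GE GI LC LU LN LG E mE.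
pose P := [set A | forall eps : R, 0 < eps -> \forall i \near Fl, L i A <= eps].
suff : P E by [].
have mE' : <<s G >> E by rewrite -GE.
apply: (dynkin_induction (P := P) GE GI) mE'.
- by apply: LG; left.
- by move=> A GA; apply: LG; right.
- move=> A mA PA eps e0; have e2 : 0 < eps / 2 by rewrite divr_gt0.
  have LT := LG setT (or_introl erefl) _ e2.
  have LA := PA _ e2.
  near=> i; apply: le_trans (LN i A mA) _.
  rewrite [leRHS]splitr lerD//; near: i; [exact: LT | exact: LA].
- move=> F mF tF PF eps e0; have e2 : 0 < eps / 2 by rewrite divr_gt0.
  have d0 : 0 < eps / 2 / (`|C| + 1) by rewrite divr_gt0// ltr_wpDl.
  have [n hn] := fine_measure_tail mF tF d0.
  set U := \bigcup_i F i in hn *; set S := \big[setU/set0]_(0 <= i < n) F i in hn *.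
  have mU : measurable U by exact: bigcup_measurable.
  have mS : measurable S by apply: bigsetU_measurable.
  have SU : S `<=` U by rewrite /S big_mkord; exact: bigsetU_bigcup.
  have PS : P S.
    rewrite /S; elim: n {hn S mS SU} => [|n IH] e he.
      rewrite big_geq//; near=> i; apply: le_trans (LC i set0 measurable0) _.
      by rewrite measure0 mulr0 ltW.
    have h2 : 0 < e / 2 by rewrite divr_gt0.
    have h3 := IH _ h2; have h4 := PF n _ h2.
    near=> i; rewrite big_nat_recr//=; apply: (le_trans (LU i _ _ _ _ _)).
    - by apply: bigsetU_measurable.
    - exact: mF.
    - rewrite big_mkord -bigcup_mkord setI_bigcupl bigcup0// => k /= kn.
      have /trivIsetP/(_ k n Logic.I Logic.I) := tF; apply; by rewrite ltn_eqF.
    rewrite [leRHS]splitr lerD//; near: i; [exact: h3 | exact: h4].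
  have := PS _ e2; apply: filterS => i hi.
  rewrite -(setDUK SU); apply: (le_trans (LU i _ _ _ _ _)) => //.
  - exact: measurableD.
  - by rewrite setDE setICA setICr setI0.
  rewrite [leRHS]splitr lerD//.
  apply: le_trans (LC i _ (measurableD mU mS)) _.
  apply: (@le_trans _ _ ((`|C| + 1) * (eps / 2 / (`|C| + 1)))); last first.
    by rewrite mulrCA divff ?mulr1// gt_eqF// ltr_wpDl.
  have C1 : C <= `|C| + 1 by rewrite (le_trans (ler_norm _))// lerDl.
  apply: le_trans (ler_wpM2r (fine_measure_ge0 _) C1) _.
  by rewrite ler_wpM2l// addr_ge0.
Unshelve. all: by end_near. Qed.

End fine_measure.

(** * Bochner density *)

Section finite_range.
Context {R : realType} {d : measure_display} {T : measurableType d}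
  (mu : {finite_measure set T -> \bar R}).
Variables (Y : choiceType) (w : T -> Y) (r : seq Y).
Hypotheses (ur : uniq r) (wr : forall t, w t \in r)
  (mw : forall y, measurable (w @^-1` [set y])).

Lemma trivIset_fibers (D : set Y) : trivIset D (fun y => w @^-1` [set y]).
Proof.
apply/trivIsetP => i j _ _ ij; apply/seteqP; split => // t [/= ti tj].
by move: ij; rewrite -ti -tj eqxx.
Qed.

Lemma fine_measure_fibers A : measurable A ->
  fine (mu A) = \sum_(y <- r) fine (mu (A `&` w @^-1` [set y])).
Proof.
move=> mA; have mAw y : measurable (A `&` w @^-1` [set y]) by exact: measurableI.
rewrite sum_fine; last by move=> y _; rewrite fin_num_measure.
rewrite fsbig_seq// -measure_fin_bigcup//; last exact/trivIset_setIl/trivIset_fibers.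
congr (fine (mu _)); rewrite -setI_bigcupr setIidl// => t _.
by exists (w t) => //=.
Qed.

Lemma measurable_finite_range d' (U : measurableType d') (f : Y -> U) :
  measurable_fun setT (f \o w).
Proof.
move=> _ B mB; rewrite setTI.
rewrite (_ : _ @^-1` _ =
  \bigcup_(y in [set y | y \in r /\ B (f y)]) w @^-1` [set y]).
  apply: fin_bigcup_measurable => //.
  by apply: (@sub_finite_set _ _ [set` r]) => // y [].
apply/seteqP; split => [t Bt|t [y [_ By] /= wt]]; first by exists (w t).
by rewrite /= wt.
Qed.

Lemma integral_fibers (f : T -> \bar R) A : measurable A ->
  measurable_fun A f -> (forall t, A t -> (0 <= f t)%E) ->
  (\int[mu]_(t in A) f t =
   \sum_(y <- r) \int[mu]_(t in A `&` w @^-1` [set y]) f t)%E.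
Proof.
move=> mA mf f0; have AU : A = \big[setU/set0]_(y <- r) (A `&` w @^-1` [set y]).
  rewrite -bigcup_seq -setI_bigcupr setIidl// => t _.
  by exists (w t) => //=.
rewrite {1}AU ge0_integral_bigsetU// -?AU//.
  by move=> y; exact: measurableI.
exact/trivIset_setIl/trivIset_fibers.
Qed.

(** The fibers of [w] may be finer than the level sets of [f \o w]. With [w] a pair of simple
    functions, both integrals become sums over one partition. *)
Lemma simple_integral_fibers (X : normedModType R) (f : Y -> X) A :
  measurable A ->
  simple_integral mu (f \o w) A =
  \sum_(y <- r) fine (mu (A `&` w @^-1` [set y])) *: f y.
Proof.
move=> mA; pose rx := undup (map f r).
have fwrx t : f (w t) \in rx by rewrite mem_undup map_f.
rewrite /simple_integral (fsbig_widen _ [set` rx]); last 2 first.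
- by move=> _ [t _ <-] /=.
- move=> x [/= _ nx]; rewrite (_ : _ `&` _ = set0) ?measure0 ?scale0r//.
  by apply/seteqP; split => // t [_ tx]; apply: nx; exists t.
rewrite -fsbig_seq ?undup_uniq//.
have mf x : measurable ((f \o w) @^-1` [set x]).
  rewrite (_ : _ @^-1` _ = \bigcup_(y in [set y | y \in r /\ f y = x]) w @^-1` [set y]).
    apply: fin_bigcup_measurable => //.
    by apply: (@sub_finite_set _ _ [set` r]) => // y [].
  apply/seteqP; split => [t <-|t [y [_ <-] /= wt]]; first by exists (w t).
  by rewrite /= wt.
under eq_bigr => x _.
  rewrite fine_measure_fibers; last exact: measurableI.
  rewrite scaler_suml; over.
rewrite exchange_big/=; apply: eq_big_seq => y yr.
rewrite (bigD1_seq (f y)) ?undup_uniq ?mem_undup ?map_f//= big1 ?addr0.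
  congr (fine (mu _) *: _); apply/seteqP; split => [t [[? _] ?]//|t [? ty]].
  by split => //; split => //=; rewrite (ty : w t = y).
move=> x xy; rewrite (_ : _ `&` _ = set0) ?measure0 ?scale0r//.
apply/seteqP; split => // t [[_ /= tx] /= ty].
by move: xy; rewrite -tx ty eqxx.
Qed.

End finite_range.

Section bochner_approximation.
Context {R : realType} {X : normedModType R} {d : measure_display}
  {T : measurableType d} (mu : {finite_measure set T -> \bar R}).

Lemma simple_fun_pair (s s' : T -> X) : simple_fun s -> simple_fun s' ->
  exists r : seq (X * X), [/\ uniq r, forall t, (s t, s' t) \in r &
    forall y, measurable ((fun t => (s t, s' t)) @^-1` [set y])].
Proof.
move=> [fs ms] [fs' ms'].
have fw : finite_set (range s `*` range s') by exact: finite_setX.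
exists (finmap.enum_fset (fset_set (range s `*` range s'))); split.
- exact: finmap.fset_uniq.
- by move=> t; rewrite in_fset_set// inE; split; [exists t|exists t].
- move=> [y y']; rewrite (_ : _ @^-1` _ = s @^-1` [set y] `&` s' @^-1` [set y']).
    exact: measurableI.
  by apply/seteqP; split => [t [/= -> ->]//|t [/= -> ->]].
Qed.

Lemma measurable_simple_dist (s s' : T -> X) : simple_fun s -> simple_fun s' ->
  measurable_fun setT (fun t => `|s t - s' t|).
Proof.
move=> ss ss'; have [r [ur wr mw]] := simple_fun_pair ss ss'.
exact: (measurable_finite_range wr mw (fun y => `|y.1 - y.2|)).
Qed.

Lemma simple_integral_dist (s s' : T -> X) A :
  simple_fun s -> simple_fun s' -> measurable A ->
  (`|simple_integral mu s A - simple_integral mu s' A|%:E <=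
   \int[mu]_(t in A) `|s t - s' t|%:E)%E.
Proof.
move=> ss ss' mA; have [r [ur wr mw]] := simple_fun_pair ss ss'.
rewrite (simple_integral_fibers mu ur wr mw (fun y => y.1) mA).
rewrite (simple_integral_fibers mu ur wr mw (fun y => y.2) mA).
rewrite (integral_fibers mu ur wr mw mA); last 2 first.
- apply/measurable_EFinP; apply: measurable_funTS.
  exact: measurable_simple_dist.
- by move=> t _; rewrite lee_fin.
rewrite -sumrB.
rewrite (eq_bigr (fun y : X * X =>
    (fine (mu (A `&` (fun t => (s t, s' t)) @^-1` [set y])) * `|y.1 - y.2|)%:E)).
  rewrite sumEFin lee_fin; apply: le_trans (ler_norm_sum _ _ _) _.
  apply: ler_sum => y _.
  by rewrite -scalerBr normrZ ger0_norm// fine_measure_ge0.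
move=> y _; rewrite (eq_integral (cst `|y.1 - y.2|%:E)).
  have mAy := measurableI _ _ mA (mw y).
  by rewrite integral_cst// EFinM (fine_measureK mu mAy) muleC.
by move=> t; rewrite inE => -[_ /= <-].
Qed.

(** Stated for arbitrary nonnegative [f], because it is applied to functions that are known to be
    measurable only off a null set. Simple functions below the restriction of [f] to [A] lie below
    [f]. *)
Lemma ge0_integral_subsetT (f : T -> \bar R) A : (forall t, (0 <= f t)%E) ->
  (\int[mu]_(t in A) f t <= \int[mu]_t f t)%E.
Proof.
move=> f0; rewrite ge0_integralE// ge0_integralTE//.
apply: ereal_sup_le => _ [h hf <-]; exists h => // t.
apply: le_trans (hf t) _; rewrite /patch; case: ifP => // _.
Qed.

(** One [s], taken from an approximation of [g] in mean, serves all families [F]: [G E] differs from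
    the integral of [s] over [E] by at most the integral of [|g - s|] over [E], and these bounds add
    up over disjoint sets. *)
Lemma bochner_approximation (g : T -> X) (G : set T -> X) (eps : R) :
  (forall E, measurable E -> is_bochner_integral mu g E (G E)) -> 0 < eps ->
  exists2 s, simple_fun s &
    forall (F : nat -> set T) n, (forall i, measurable (F i)) ->
      trivIset setT F ->
      \sum_(0 <= i < n) `|G (F i) - simple_integral mu s (F i)| <= eps.
Proof.
move=> gG e0; have [[u [su [N [mN N0 uN]]]] [s0 [ss0 s00 _]]] := gG _ measurableT.
have [s ss gs] : exists2 s, simple_fun s & (\int[mu]_t `|g t - s t|%:E <= eps%:E)%E.
  move/fine_cvgP : s00 => [+ /cvgrPdist_le/(_ _ e0)].
  move=> [a _ Ha] [b _ Hb]; exists (s0 (maxn a b)) => //.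
  have := Hb (maxn a b) (leq_maxr _ _); rewrite /= sub0r normrN.
  have /= := Ha (maxn a b) (leq_maxl _ _) => fn hle.
  by rewrite -(fineK fn) lee_fin (le_trans (ler_norm _)).
(* [g] is only an almost everywhere limit of simple functions, so the functions
   [`|g t - s t|] are known to be measurable only off the null set [N]. *)
exists s => // F n mF tF.
have mD : measurable (~` N) by exact: measurableC.
have ug t : (~` N) t -> u k t @[k --> \oo] --> g t.
  by move=> Nt; apply: contrapT => h; apply: Nt; exact: uN.
have mg s' : simple_fun s' -> measurable_fun (~` N) (fun t => `|g t - s' t|).
  move=> ss'; apply: (@measurable_fun_cvg _ _ _ _ (fun k t => `|u k t - s' t|)).
    by move=> k; apply: measurable_funTS; exact: measurable_simple_dist.
  by move=> t Nt; apply: cvg_norm; apply: cvgB; [exact: ug|exact: cvg_cst].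
have SN (s' : T -> X) A : simple_fun s' -> measurable A ->
    simple_integral mu s' A = simple_integral mu s' (A `&` ~` N).
  move=> [_ ms'] mA; apply: eq_fsbigr => y _; congr (_ *: _).
  have mB : measurable (A `&` s' @^-1` [set y]) by exact: measurableI.
  have BN0 : fine (mu ((A `&` s' @^-1` [set y]) `&` N)) = 0.
    apply/eqP; rewrite eq_le fine_measure_ge0 andbT.
    have -> : 0 = fine (mu N) by rewrite N0.
    by apply: le_fine_measure => //; exact: measurableI.
  rewrite -[X in fine (mu X) = _](setUIDK _ N) fine_measureU ?BN0 ?add0r; last 3 first.
  - exact: measurableI.
  - exact: measurableD.
  - by rewrite setDE setIACA setICr setI0.
  by rewrite setDE setIAC.
(* The approximating sequence attached to [A] may differ from the one that gave [s]; a late term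
   [s' k] of it serves as an intermediate, with two errors of at most [e / 2]. *)
have key A : measurable A ->
    (`|G A - simple_integral mu s A|%:E <=
     \int[mu]_(t in A `&` ~` N) `|g t - s t|%:E)%E.
  move=> mA; have [_ [s' [ss' s'0 s'G]]] := gG _ mA.
  have mAN : measurable (A `&` ~` N) by exact: measurableI.
  have mgA s1 : simple_fun s1 -> measurable_fun (A `&` ~` N) (fun t => `|g t - s1 t|%:E).
    by move=> ?; apply/measurable_EFinP; apply: measurable_funS (mg _ _).
  apply/lee_addgt0Pr => e e_gt0; have e2 : 0 < e / 2 by rewrite divr_gt0.
  move/fine_cvgP : s'0 => [[a _ Ha] /cvgrPdist_le/(_ _ e2)[b _ Hb]].
  move/cvgrPdist_le : s'G => /(_ _ e2)[c _ Hc].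
  pose k := maxn a (maxn b c).
  have fk := Ha k (leq_maxl _ _).
  have ek : (\int[mu]_t `|g t - s' k t|%:E <= (e / 2)%:E)%E.
    have := Hb k (leq_trans (leq_maxl _ _) (leq_maxr _ _)).
    rewrite /= sub0r normrN => hle.
    by rewrite -(fineK fk) lee_fin (le_trans (ler_norm _)).
  have Gk := Hc k (leq_trans (leq_maxr _ _) (leq_maxr _ _)).
  apply: (@le_trans _ _ ((e / 2)%:E +
      `|simple_integral mu (s' k) A - simple_integral mu s A|%:E)%E).
    rewrite -EFinD lee_fin; apply: le_trans (ler_distD (simple_integral mu (s' k) A) _ _) _.
    by rewrite lerD2r.
  rewrite [in leRHS](splitr e) EFinD addeA addeC leeD2l//.
  rewrite (SN (s' k))// (SN s)//.
  apply: (le_trans (simple_integral_dist (ss' k) ss mAN)).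
  apply: (@le_trans _ _ (\int[mu]_(t in A `&` ~` N) (`|g t - s t|%:E + `|g t - s' k t|%:E))%E).
    apply: ge0_le_integral => //.
    - by apply/measurable_EFinP; apply: measurable_funTS; exact: measurable_simple_dist.
    - by apply: emeasurable_funD; exact: mgA.
    - move=> t _; rewrite -EFinD lee_fin [leRHS]addrC [`|g t - s' k t|]distrC.
      exact: ler_distD.
  rewrite ge0_integralD//; [|exact: mgA..].
  apply: leeD => //; apply: le_trans ek; exact: ge0_integral_subsetT.
have mFN i : measurable (F i `&` ~` N) by exact: measurableI.
rewrite -lee_fin -sumEFin; apply: le_trans gs.
apply: le_trans (lee_sum _ (fun i _ => key _ (mF i))) _.
rewrite -ge0_integral_bigsetU//.
- exact: ge0_integral_subsetT.
- exact: iota_uniq.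
- exact/(sub_trivIset (@subsetT _ _))/trivIset_setIr.
apply/measurable_EFinP; apply: measurable_funS (mg _ ss) => //.
by rewrite big_mkord -(bigcup_mkord n (fun i => F i `&` ~` N)) => t [i _ []].
Qed.

End bochner_approximation.

(** * Nested partitions *)

Lemma sum_nat_mul (V : nmodType) (k n : nat) (F : nat -> V) :
  \sum_(0 <= j < k * n) F j =
  \sum_(0 <= i < k) \sum_(0 <= l < n) F (i * n + l)%N.
Proof.
rewrite big_nat_mul; apply: eq_bigr => i _.
rewrite -{1}(addn0 (i * n)%N) addnC big_addn mulSn addnK.
by apply: eq_bigr => l _; rewrite addnC.
Qed.

Definition cell (T : Type) (xi : nat -> T -> nat) n i : set T :=
  xi n @^-1` [set i].

(* [set0] makes this family closed under intersections. *)
Definition cells (T : Type) (xi : nat -> T -> nat) : set (set T) :=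
  [set A | A = set0 \/ exists n i, A = cell xi n i].

Section cells.
Context {R : realType} {d : measure_display} {T : measurableType d}
  (mu : {finite_measure set T -> \bar R}) (K N : nat -> nat)
  (xi : nat -> T -> nat).

Local Notation cell := (cell xi).
Local Notation cells := (cells xi).

(* [xi n t] is the number of the cell of level [n] that contains [t]; each of the
   [K n] cells of level [n], all of measure [1 / K n], is divided into [N n]
   cells of level [n.+1]. *)
Record cell_filtration : Prop := CellFiltration {
  level0 : K 0 = 1%N;
  level_gt0 : forall n, (0 < N n)%N;
  levelS : forall n, K n.+1 = (K n * N n)%N;
  level_lt : forall n t, (xi n t < K n)%N;
  level_div : forall n t, xi n t = (xi n.+1 t %/ N n)%N;
  measure_cell : forall n i, (i < K n)%N -> mu (cell n i) = ((K n)%:R^-1)%:E;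
  measurable_cells : @measurable _ T = <<s cells >> }.

Hypothesis HF : cell_filtration.

Let mass n i E : R := fine (mu (E `&` cell n i)).

Lemma measurable_cell n i : measurable (cell n i).
Proof.
rewrite (measurable_cells HF); apply: sub_gen_smallest.
by right; exists n, i.
Qed.
Hint Resolve measurable_cell : core.

Lemma level_factor n m : (n <= m)%N ->
  exists h : nat -> nat, forall t, xi n t = h (xi m t).
Proof.
elim: m => [|m IH]; first by rewrite leqn0 => /eqP ->; exists id.
rewrite leq_eqVlt => /orP[/eqP ->|]; first by exists id.
rewrite ltnS => /IH[h hE]; exists (fun j => h (j %/ N m)%N) => t.
by rewrite hE (level_div HF).
Qed.

Lemma cellI n m i j : (n <= m)%N ->
  cell n i `&` cell m j = cell m j \/ cell n i `&` cell m j = set0.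
Proof.
move=> /level_factor[h hE]; have [hj|hj] := eqVneq (h j) i; [left|right].
  apply/seteqP; split => [t []//|t tj]; split => //.
  by change (xi n t = i); rewrite hE (tj : xi m t = j).
apply/seteqP; split => // t [ti tj]; move: hj.
by rewrite -(ti : xi n t = i) hE (tj : xi m t = j) eqxx.
Qed.

Lemma setI_closed_cells : setI_closed cells.
Proof.
move=> A B [->|[n [i ->]]]; first by rewrite set0I => _; left.
move=> [->|[m [j ->]]]; first by rewrite setI0; left.
have [nm|/ltnW mn] := leqP n m.
  by case: (cellI i j nm) => ->; [right; exists m, j|left].
by rewrite setIC; case: (cellI j i mn) => ->; [right; exists n, i|left].
Qed.

Lemma level_pos n : 0 < (N n)%:R :> R.
Proof. by rewrite ltr0n (level_gt0 HF). Qed.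

Lemma cell_massT n i : (i < K n)%N -> mass n i setT = (K n)%:R^-1.
Proof. by move=> ik; rewrite /mass setTI (measure_cell HF). Qed.

Lemma cell_massU n i A B : measurable A -> measurable B -> A `&` B = set0 ->
  mass n i (A `|` B) = mass n i A + mass n i B.
Proof.
move=> mA mB AB; rewrite /mass setIUl fine_measureU//; try exact: measurableI.
by rewrite setIACA AB set0I.
Qed.

Lemma cell_massC n i A : measurable A -> mass n i (~` A) = mass n i setT - mass n i A.
Proof.
move=> mA; rewrite -(setUv A) cell_massU ?setICr//; last exact: measurableC.
by rewrite addrC addKr.
Qed.

Lemma cell_mass_sum n E : measurable E ->
  \sum_(0 <= i < K n) mass n i E = fine (mu E).
Proof.
move=> mE; have xiK t : xi n t \in index_iota 0 (K n).
  by rewrite mem_index_iota (level_lt HF).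
by rewrite (fine_measure_fibers mu (iota_uniq _ _) xiK (measurable_cell n) mE).
Qed.

(** Spreads a sum over parents evenly over their children, so that it can be compared term by term
    with sums over the next level. *)
Lemma sum_div_level n (f : nat -> R) :
  \sum_(0 <= j < K n.+1) (N n)%:R^-1 * f (j %/ N n)%N = \sum_(0 <= i < K n) f i.
Proof.
rewrite (levelS HF) sum_nat_mul; apply: eq_bigr => i _.
rewrite (eq_big_nat _ _ (F2 := fun=> (N n)%:R^-1 * f i)).
  rewrite sumr_const_nat subn0 -[LHS]mulr_natl mulVKf//.
  by rewrite gt_eqF// level_pos.
by move=> l ln; rewrite divnMDl ?(level_gt0 HF)// divn_small// addn0.
Qed.

(* Compares the proportion of each cell occupied by [E] with the proportion of
   its parent occupied by [E]; it vanishes once [E] is a union of cells. *)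
Definition cell_defect n E : R :=
  \sum_(0 <= j < K n.+1) `|mass n.+1 j E - mass n (j %/ N n) E / (N n)%:R|.
Local Notation D := cell_defect.

Lemma cell_defect_le n E : measurable E -> D n E <= 2 * fine (mu E).
Proof.
move=> mE; apply: (@le_trans _ _
  (\sum_(0 <= j < K n.+1) (mass n.+1 j E + mass n (j %/ N n) E / (N n)%:R))).
  apply: ler_sum => j _; apply: le_trans (ler_normB _ _) _.
  by rewrite !ger0_norm ?mulr_ge0 ?invr_ge0 ?fine_measure_ge0.
rewrite big_split/= cell_mass_sum// mulr2n mulrDl mul1r lerD2l.
rewrite -[leRHS](cell_mass_sum n)// -sum_div_level le_eqVlt; apply/orP; left.
by apply/eqP; apply: eq_bigr => j _; rewrite mulrC.
Qed.

Lemma cell_defectU n A B : measurable A -> measurable B -> A `&` B = set0 ->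
  D n (A `|` B) <= D n A + D n B.
Proof.
move=> mA mB AB; rewrite -big_split/=; apply: ler_sum => j _.
rewrite !cell_massU// mulrDl; apply: le_trans (ler_normD _ _).
by rewrite le_eqVlt; apply/orP; left; apply/eqP; congr `| _ |; ring.
Qed.

Lemma cell_defectC n A : measurable A -> D n (~` A) <= D n setT + D n A.
Proof.
move=> mA; rewrite -big_split/=; apply: ler_sum => j _.
rewrite !cell_massC// mulrBl; apply: le_trans (ler_normB _ _).
by rewrite le_eqVlt; apply/orP; left; apply/eqP; congr `| _ |; ring.
Qed.

Lemma cell_defectT n : D n setT = 0.
Proof.
rewrite /D big_nat big1// => j jK; rewrite !cell_massT//; last first.
  by rewrite ltn_divLR ?(level_gt0 HF)// -(levelS HF).
by rewrite (levelS HF) natrM invfM subrr normr0.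
Qed.

(** From level [n] on, every cell lies either inside or outside the given one, and all children of a
    cell have equal measure. *)
Lemma cell_defect_cell n m i : (n <= m)%N -> D m (cell n i) = 0.
Proof.
move=> /level_factor[h hE]; rewrite /D big_nat big1// => j jK.
have cE k p (g : nat -> nat) : (forall t, xi n t = g (xi k t)) ->
  mass k p (cell n i) = if g p == i then mass k p setT else 0.
  move=> gE; case: eqP => [gp|gp]; rewrite /mass.
    congr (fine (mu _)); rewrite setTI; apply/seteqP; split => [t []//|t tp].
    by split => //; change (xi n t = i); rewrite gE (tp : xi k t = p).
  rewrite (_ : _ `&` _ = set0) ?measure0//; apply/seteqP; split => // t [ti tp].
  by apply: gp; rewrite -(ti : xi n t = i) gE (tp : xi k t = p).
rewrite (cE m _ _ hE) (cE m.+1 _ (fun j => h (j %/ N m)%N)); last first.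
  by move=> t; rewrite hE (level_div HF).
case: eqP => _; last by rewrite mul0r subrr normr0.
rewrite !cell_massT//; last first.
  by rewrite ltn_divLR ?(level_gt0 HF)// -(levelS HF).
by rewrite (levelS HF) natrM invfM subrr normr0.
Qed.

(** [D n E] is the [L^1] distance between the conditional expectations of the indicator of [E] at
    levels [n] and [n.+1]. It vanishes eventually for cells, and [dynkin_small] carries the
    smallness over to all measurable sets. *)
Lemma cell_defect_small E (eps : R) : measurable E -> 0 < eps ->
  \forall n \near \oo, D n E <= eps.
Proof.
move=> mE; move: eps; apply: (dynkin_small (G := cells) (C := 2)
  (L := fun n E => D n E)) mE => //.
- exact: measurable_cells.
- exact: setI_closed_cells.
- by move=> *; exact: cell_defect_le.
- by move=> *; exact: cell_defectU.
- by move=> *; exact: cell_defectC.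
- move=> A HA eps e0; suff [n Hn] : exists n, forall m, (n <= m)%N -> D m A = 0.
    by exists n => // m /= nm; rewrite Hn// ltW.
  case: HA => [->|[->|[n [i ->]]]].
  + by exists 0 => m _; exact: cell_defectT.
  + exists 0 => m _; apply/eqP; rewrite eq_le; apply/andP; split.
      by rewrite (le_trans (cell_defect_le _ _))// measure0 mulr0.
    by rewrite sumr_ge0.
  + by exists n => m nm; exact: cell_defect_cell.
Qed.

End cells.

(** * Quasi-martingales *)

Lemma cvgn_of_cauchy (R : realType) (V : completeNormedModType R) (u : nat -> V) :
  (forall eps : R, 0 < eps ->
    \forall p \near (\oo, \oo), `|u p.1 - u p.2| <= eps) -> cvgn u.
Proof.
move=> uC; apply/cauchy_cvgP/cauchy_ballP => eps e0.
have e2 : 0 < eps / 2 by rewrite divr_gt0.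
rewrite near_map2; apply: filterS (uC _ e2) => -[p q] /= h.
rewrite -ball_normE /=; apply: le_lt_trans h _.
by rewrite ltr_pdivrMr// ltr_pMr// ltr1n.
Qed.

Lemma nneg_series_tail (R : realType) (u : nat -> R) (C eps : R) :
  (forall n, 0 <= u n) -> (forall n, \sum_(0 <= k < n) u k <= C) -> 0 < eps ->
  exists n, forall p q, (n <= p)%N -> (n <= q)%N -> \sum_(p <= k < q) u k <= eps.
Proof.
move=> u0 uC e0.
have : cvgn (series u).
  apply: nondecreasing_is_cvgn; first exact: nondecreasing_series.
  by exists C => _ [n _ <-]; exact: uC.
move=> /cauchy_cvgP/cauchy_seriesP/(_ _ e0)[[A B] [[a _ Aa] [b _ Bb]] H].
exists (maxn a b) => p q; rewrite !geq_max => /andP[ap bp] /andP[aq bq].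
apply: le_trans (ler_norm _) (ltW _).
by apply: (H (p, q)); split; [exact: Aa | exact: Bb].
Qed.

Section process.
Context {R : realType} {X : completeNormedModType R}
  {d : measure_display} {T : measurableType d}
  (mu : {finite_measure set T -> \bar R}) (K N : nat -> nat)
  (xi : nat -> T -> nat) (HF : cell_filtration mu K N xi)
  (x : nat -> nat -> X) (x1 : forall n i, `|x n i| <= 1).

Local Notation a n i E := (fine (mu (E `&` cell xi n i))).
Local Notation D := (cell_defect mu K N xi).

Definition child_mean n i : X :=
  (N n)%:R^-1 *: \sum_(0 <= l < N n) x n.+1 (i * N n + l)%N.

(* The [L^1] norm of the conditional mean increment of the process
   [t |-> x n (xi n t)] from time [n] to time [n.+1]. *)
Definition drift n : R :=
  \sum_(0 <= i < K n) (K n)%:R^-1 * `|x n i - child_mean n i|.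

(* The integral over [E] of [t |-> x n (xi n t)]. *)
Definition process_integral n E : X := \sum_(0 <= i < K n) a n i E *: x n i.
Local Notation A := process_integral.

Lemma drift_ge0 n : 0 <= drift n.
Proof. by apply: sumr_ge0 => i _; rewrite mulr_ge0// invr_ge0. Qed.

Lemma norm_process_integral n E : measurable E -> `|A n E| <= fine (mu E).
Proof.
move=> mE; rewrite -(cell_mass_sum HF n mE); apply: le_trans (ler_norm_sum _ _ _) _.
apply: ler_sum => i _; rewrite normrZ ger0_norm ?fine_measure_ge0//.
by rewrite ler_piMr// fine_measure_ge0.
Qed.

Lemma process_integralU n E E' : measurable E -> measurable E' ->
  E `&` E' = set0 -> A n (E `|` E') = A n E + A n E'.
Proof.
move=> mE mE' EE'; rewrite -big_split/=; apply: eq_bigr => i _.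
by rewrite -scalerDl (cell_massU HF).
Qed.

(** The change has two sources: [E] may be unevenly divided among the children of a cell, which
    costs at most [D n E] since the values have norm at most 1, and the mean over the children may
    differ from the value at the parent. *)
Lemma process_integral_step n E : measurable E ->
  `|A n.+1 E - A n E| <=
    D n E + \sum_(0 <= i < K n) a n i E * `|x n i - child_mean n i|.
Proof.
move=> mE.
have -> : A n.+1 E - A n E =
    \sum_(0 <= j < K n.+1) (a n.+1 j E - a n (j %/ N n) E / (N n)%:R) *: x n.+1 j
    - \sum_(0 <= i < K n) a n i E *: (x n i - child_mean n i).
  have E1 : \sum_(0 <= j < K n.+1) (a n (j %/ N n) E / (N n)%:R) *: x n.+1 j =
    \sum_(0 <= i < K n) a n i E *: child_mean n i.
    rewrite (levelS HF) sum_nat_mul; apply: eq_bigr => i _.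
    rewrite /child_mean scalerA scaler_sumr; apply: eq_big_nat => l ln.
    by rewrite divnMDl ?(level_gt0 HF)// divn_small// addn0.
  under [X in _ = X - _]eq_bigr do rewrite scalerBl.
  under [X in _ = _ - X]eq_bigr do rewrite scalerBr.
  by rewrite !sumrB E1 opprB addrA subrK.
apply: le_trans (ler_normB _ _) _; apply: lerD; apply: le_trans (ler_norm_sum _ _ _) _.
  by apply: ler_sum => j _; rewrite normrZ ler_piMr.
by apply: ler_sum => j _; rewrite normrZ ger0_norm ?fine_measure_ge0.
Qed.

(** On cells of level [n] the defect at level [m] is zero, so only the mean increments remain;
    summed over [k], their weights add up to the full measures of the cells of level [m]. *)
Lemma process_integral_cells n m : (n <= m)%N ->
  \sum_(0 <= k < K n) `|A m.+1 (cell xi n k) - A m (cell xi n k)| <= drift m.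
Proof.
move=> nm; apply: (@le_trans _ _ (\sum_(0 <= k < K n) \sum_(0 <= i < K m)
    a m i (cell xi n k) * `|x m i - child_mean m i|)).
  apply: ler_sum => k _; apply: le_trans (process_integral_step _ _) _.
    exact: (measurable_cell HF).
  by rewrite (cell_defect_cell HF)// add0r.
rewrite exchange_big_nat/= le_eqVlt; apply/orP; left; apply/eqP.
apply: eq_big_nat => i im; rewrite -mulr_suml; congr (_ * _).
rewrite -(cell_massT HF im) setTI.
rewrite -(cell_mass_sum HF n (measurable_cell HF m i)).
by apply: eq_bigr => k _; rewrite setIC.
Qed.

Context (C : R) (drift_sum : forall n, \sum_(0 <= k < n) drift k <= C).

Lemma process_integral_cells_dist n p q : (n <= p)%N -> (p <= q)%N ->
  \sum_(0 <= k < K n) `|A q (cell xi n k) - A p (cell xi n k)| <=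
  \sum_(p <= k < q) drift k.
Proof.
move=> np; elim: q => [|q IH].
  by rewrite leqn0 => /eqP ->; rewrite [leRHS]big_geq// big1// => k _; rewrite subrr normr0.
rewrite leq_eqVlt => /orP[/eqP <-|].
  by rewrite [leRHS]big_geq// big1// => k _; rewrite subrr normr0.
rewrite ltnS => pq; rewrite big_nat_recr//=.
apply: le_trans (lerD (IH pq) (process_integral_cells (leq_trans np pq))).
rewrite -big_split/=; apply: ler_sum => k _.
by rewrite addrC (le_trans _ (ler_normD _ _))// addrA subrK.
Qed.

(** On a single cell the change is bounded by a tail of the drift series; [dynkin_small], for the
    product filter, extends this to measurable sets. *)
Lemma process_integral_cauchy B (eps : R) : measurable B -> 0 < eps ->
  \forall p \near (\oo, \oo), `|A p.1 B - A p.2 B| <= eps.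
Proof.
move=> mB; move: eps; apply: (dynkin_small (mu := mu)
  (Fl := filter_prod \oo \oo) (G := cells xi) (C := 2)
  (L := fun p E => `|A p.1 E - A p.2 E|)) mB => //.
- exact: (measurable_cells HF).
- exact: setI_closed_cells HF.
- move=> p E mE; apply: le_trans (ler_normB _ _) _.
  by rewrite mulr2n mulrDl mul1r lerD// norm_process_integral.
- move=> p E E' mE mE' EE'; rewrite !process_integralU// opprD addrACA.
  exact: ler_normD.
- move=> p E mE.
  have h n : A n (~` E) = A n setT - A n E.
    rewrite -(setUv E) process_integralU// ?setICr//; last exact: measurableC.
    by rewrite addrC addKr.
  by rewrite !h opprD opprK addrACA (le_trans (ler_normD _ _))// lerD// addrC distrC.
move=> E HE eps e0; have [n0 Hn0] := nneg_series_tail drift_ge0 drift_sum e0.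
suff [n Hn] : exists n, forall p q, (n <= p)%N -> (p <= q)%N -> `|A q E - A p E| <= eps.
  exists ([set m | (n <= m)%N], [set m | (n <= m)%N]); first by split; exists n.
  move=> [p q] [/= np nq]; have [pq|/ltnW qp] := leqP p q.
    by rewrite distrC; exact: Hn.
  exact: Hn.
have cellP n i : exists m, forall p q, (m <= p)%N -> (p <= q)%N ->
    `|A q (cell xi n i) - A p (cell xi n i)| <= eps.
  (* For [i >= K n] the cell is empty. *)
  have [iK|iK] := ltnP i (K n); last first.
    exists 0 => p q _ _; rewrite (_ : cell xi n i = set0).
      have h m : A m set0 = 0.
        by rewrite /A big1// => j _; rewrite set0I measure0 scale0r.
      by rewrite !h subrr normr0 ltW.
    apply/seteqP; split => // t ti; have := level_lt HF n t.
    by rewrite (ti : xi n t = i) ltnNge iK.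
  exists (maxn n n0) => p q; rewrite geq_max => /andP[np n0p] pq.
  apply: le_trans (Hn0 _ _ n0p (leq_trans n0p pq)).
  apply: le_trans (process_integral_cells_dist np pq).
  rewrite big_mkord (bigD1 (Ordinal iK))//= lerDl.
  by rewrite sumr_ge0.
(* As [K 0 = 1], the whole space is cell [0] of level [0], and cell [1] of that level is empty; both
   cases reduce to [cellP]. *)
case: HE => [->|[->|[n [i ->]]]]; last exact: cellP.
  rewrite (_ : setT = cell xi 0 0)//; apply/seteqP; split => // t _.
  by have := level_lt HF 0 t; rewrite (level0 HF) ltnS leqn0 => /eqP.
rewrite (_ : set0 = cell xi 0 1)//; apply/seteqP; split => // t t1.
by have := level_lt HF 0 t; rewrite (level0 HF) (t1 : xi 0 t = 1%N).
Qed.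
End process.

(** * The limit of the process as a vector measure *)

Section limit.
Context {R : realType} {X : completeNormedModType R}
  {d : measure_display} {T : measurableType d}
  (mu : {finite_measure set T -> \bar R}) (K N : nat -> nat)
  (xi : nat -> T -> nat) (HF : cell_filtration mu K N xi)
  (x : nat -> nat -> X) (x1 : forall n i, `|x n i| <= 1)
  (C : R) (drift_sum : forall n, \sum_(0 <= k < n) drift K N x k <= C).
Local Notation A := (process_integral mu K xi x).

Definition process_limit E : X := limn (fun n => A n E).
Local Notation G := process_limit.

Lemma process_limit_cvg E : measurable E -> A n E @[n --> \oo] --> G E.
Proof.
by move=> mE; apply: cvgn_of_cauchy => eps; exact: (process_integral_cauchy HF x1 drift_sum).
Qed.

(** This domination by [mu] is the source of the countable additivity, the bounded variation and the
    continuity of the limit. *)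
Lemma norm_process_limit E : measurable E -> `|G E| <= fine (mu E).
Proof.
move=> mE; apply: cvgr_to_le (cvg_norm (process_limit_cvg mE)) _.
by near=> n; exact: (norm_process_integral HF).
Unshelve. all: by end_near. Qed.

Lemma process_limitU E E' : measurable E -> measurable E' ->
  E `&` E' = set0 -> G (E `|` E') = G E + G E'.
Proof.
move=> mE mE' EE'; apply: cvg_lim => //.
rewrite (_ : (fun n => A n (E `|` E')) = (fun n => A n E + A n E')).
  by apply: cvgD; exact: process_limit_cvg.
by apply/funext => n; exact: (process_integralU HF).
Qed.

Lemma process_limit_bigsetU (F : nat -> set T) n :
  (forall i, measurable (F i)) -> trivIset setT F ->
  G (\big[setU/set0]_(0 <= i < n) F i) = \sum_(0 <= i < n) G (F i).
Proof.
move=> mF tF; elim: n => [|n IH].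
  rewrite !big_geq//; apply/eqP; rewrite -normr_le0.
  by rewrite (le_trans (norm_process_limit measurable0))// measure0.
rewrite !big_nat_recr//= process_limitU ?IH//; first exact: bigsetU_measurable.
rewrite big_mkord -bigcup_mkord setI_bigcupl bigcup0// => k /= kn.
by have /trivIsetP/(_ k n Logic.I Logic.I) := tF; apply; rewrite ltn_eqF.
Qed.

Lemma process_limit_vector_measure : vector_measure G.
Proof.
move=> F mF tF; apply/cvgrPdist_le => eps e0.
have [n hn] := fine_measure_tail mu mF tF e0.
exists n => // m /= nm.
have mS k : measurable (\big[setU/set0]_(0 <= i < k) F i).
  exact: bigsetU_measurable.
have mU : measurable (\bigcup_i F i) by exact: bigcup_measurable.
have SU k : \big[setU/set0]_(0 <= i < k) F i `<=` \bigcup_i F i.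
  by rewrite big_mkord; exact: bigsetU_bigcup.
rewrite -{1}(setDUK (SU m)) process_limitU//; last 2 first.
- exact: measurableD.
- by rewrite setDE setICA setICr setI0.
rewrite process_limit_bigsetU// addrC addKr.
apply: le_trans (norm_process_limit _) _; first exact: measurableD.
apply: le_trans hn; apply: le_fine_measure; try exact: measurableD.
apply: setDS; rewrite !big_mkord; exact: subset_bigsetU.
Qed.

Lemma process_limit_bounded_variation : vm_bounded_variation G.
Proof.
apply: (@le_lt_trans _ _ (fine (mu setT))%:E); last by rewrite ltry.
apply: ge_ereal_sup => _ [n [F [mF tF UF ->]]]; rewrite lee_fin.
apply: (@le_trans _ _ (\sum_(i < n) fine (mu (F i)))).
  by apply: ler_sum => i _; exact: norm_process_limit.
rewrite sum_fine; last by move=> i _; rewrite fin_num_measure.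
rewrite le_eqVlt; apply/orP; left; apply/eqP; congr fine.
rewrite -UF measure_fin_bigcup//; last exact: finite_finset.
rewrite (fsbigE (enum 'I_n)) ?enum_uniq//; last by move=> i _; rewrite mem_enum.
by rewrite -big_enum/=; apply: eq_bigl => i; rewrite in_setT.
Qed.

Lemma process_limit_continuous : vm_continuous mu G.
Proof.
move=> E mE E0; apply/eqP; rewrite -normr_le0.
by rewrite (le_trans (norm_process_limit mE))// E0.
Qed.

(** The process integral of level [n] over its own cell [i] is exactly [(K n)%:R^-1 *: x n i]; the
    later changes are controlled by the drift. *)
Lemma process_limit_cells n (eps : R) :
  (forall m, (n <= m)%N -> \sum_(n <= k < m) drift K N x k <= eps) ->
  \sum_(0 <= i < K n) `|(K n)%:R^-1 *: x n i - G (cell xi n i)| <= eps.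
Proof.
move=> h.
have mc i : measurable (cell xi n i) := measurable_cell HF n i.
have An i : (i < K n)%N -> A n (cell xi n i) = (K n)%:R^-1 *: x n i.
  move=> iK; rewrite /process_integral big_mkord (bigD1 (Ordinal iK))//= setIid.
  rewrite (measure_cell HF)//= big1 ?addr0// => -[j jK] /= ji.
  have /trivIsetP/(_ i j Logic.I Logic.I) -> := trivIset_fibers (w := xi n) (D := setT).
    by rewrite measure0 scale0r.
  by apply: contraNneq ji => ij; apply/eqP/val_inj.
rewrite (eq_big_nat _ _
    (F2 := fun i => `|G (cell xi n i) - A n (cell xi n i)|)); last first.
  by move=> i /andP[_ iK]; rewrite distrC An.
apply: (@cvgr_to_le _ \oo _ _
  (fun m => \sum_(0 <= i < K n) `|A m (cell xi n i) - A n (cell xi n i)|)).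
  apply: (@cvg_big _ _ +%R) => [|i _]; first exact: add_continuous.
  by apply: cvg_norm; apply: cvgB; [exact: process_limit_cvg|exact: cvg_cst].
exists n => // m /= nm; apply: le_trans (h _ nm).
exact: (process_integral_cells_dist HF).
Qed.

End limit.

(** * Small increments from the Radon-Nikodym property *)

Section increments.
Context {R : realType} {X : completeNormedModType R} (X_RNP : radon_nikodym_property X)
  {d : measure_display} {T : measurableType d}
  (mu : {finite_measure set T -> \bar R}) (K N : nat -> nat)
  (xi : nat -> T -> nat) (HF : cell_filtration mu K N xi)
  (x : nat -> nat -> X) (x1 : forall n i, `|x n i| <= 1)
  (C : R) (drift_sum : forall n, \sum_(0 <= k < n) drift K N x k <= C).

(** The left-hand side is at most the sum of the defects of the finitely many fibers of [s],
    weighted by the norms of the values. *)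
Lemma simple_integral_defect (s : T -> X) (eps : R) : simple_fun s -> 0 < eps ->
  \forall n \near \oo, \sum_(0 <= j < K n.+1)
    `|simple_integral mu s (cell xi n.+1 j) -
      (N n)%:R^-1 *: simple_integral mu s (cell xi n (j %/ N n))| <= eps.
Proof.
(* Pairing [s] with itself merely provides a list of its fibers. *)
move=> ss e0; have [r [ur wr mw]] := simple_fun_pair ss ss.
pose D n y := cell_defect mu K N xi n ((fun t => (s t, s t)) @^-1` [set y]).
have sE E := simple_integral_fibers mu ur wr mw (fun y => y.1) (A := E).
have mc n j : measurable (cell xi n j) := measurable_cell HF n j.
have le_D n : \sum_(0 <= j < K n.+1)
    `|simple_integral mu s (cell xi n.+1 j) -
      (N n)%:R^-1 *: simple_integral mu s (cell xi n (j %/ N n))| <=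
    \sum_(y <- r) `|y.1| * D n y.
  under [leRHS]eq_bigr do rewrite mulr_sumr.
  rewrite [leRHS]exchange_big/=; apply: ler_sum => j _.
  rewrite !(sE _ (mc _ _)) scaler_sumr -sumrB.
  apply: le_trans (ler_norm_sum _ _ _) _; apply: ler_sum => y _.
  rewrite scalerA -scalerBl normrZ mulrC.
  by rewrite [(N n)%:R^-1 * _]mulrC ![cell _ _ _ `&` _]setIC.
pose d1 := eps / (\sum_(y <- r) `|y.1| + 1).
have d0 : 0 < d1 by rewrite divr_gt0// ltr_wpDl// sumr_ge0.
have [n0 _ Hn0] : \forall n \near \oo, forall y, y \in r -> D n y <= d1.
  move: d1 d0 => d1 d0; elim: (r) => [|y r' IH]; first by near=> n => y.
  have Dy := cell_defect_small HF (mw y) d0.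
  near=> n => z; rewrite inE => /orP[/eqP ->|]; first by near: n.
  by move: z; near: n.
exists n0 => // n /= n0n; apply: le_trans (le_D n) _.
apply: (@le_trans _ _ (\sum_(y <- r) `|y.1| * d1)).
  rewrite big_seq [leRHS]big_seq; apply: ler_sum => y yr.
  by rewrite ler_wpM2l//; exact: Hn0.
rewrite -mulr_suml /d1 mulrCA ler_piMr//; first exact: ltW.
rewrite ler_pdivrMr ?mul1r ?lerDl//.
by rewrite ltr_wpDl// sumr_ge0.
Unshelve. all: by end_near. Qed.

Theorem rnp_increment_small (eps : R) : 0 < eps ->
  exists n, \sum_(0 <= j < K n.+1)
    (K n.+1)%:R^-1 * `|x n.+1 j - x n (j %/ N n)%N| <= eps.
Proof.
move=> e0; pose G := process_limit mu K xi x.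
(* One fifth for each link of the chain: value at the child, mean of [G] over the child, mean of [s]
   over the child, mean of [s] over the parent, mean of [G] over the parent, value at the parent. *)
have e5 : 0 < eps / 5 by rewrite divr_gt0.
have [g gG] := X_RNP (process_limit_vector_measure HF x1 drift_sum)
  (process_limit_bounded_variation HF x1 drift_sum)
  (process_limit_continuous HF x1 drift_sum).
have [s ss sG] := bochner_approximation gG e5.
pose S := simple_integral mu s.
have [n0 Hn0] := nneg_series_tail (drift_ge0 K N x) drift_sum e5.
have [n1 _ Hn1] := simple_integral_defect ss e5.
pose n := maxn n0 n1.
have n0n : (n0 <= n)%N by rewrite leq_maxl.
have := Hn1 n (leq_maxr _ _) => /= {Hn1}.
set S3 := (X in X <= _) => h3.
pose c m i := cell xi m i.
have h1 : \sum_(0 <= j < K n.+1) `|(K n.+1)%:R^-1 *: x n.+1 j - G (c n.+1 j)| <= eps / 5.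
  apply: (process_limit_cells HF x1 drift_sum) => m nm.
  by apply: Hn0; [exact: leqW|apply: leq_trans n0n (ltnW nm)].
have h5 : \sum_(0 <= i < K n) `|(K n)%:R^-1 *: x n i - G (c n i)| <= eps / 5.
  apply: (process_limit_cells HF x1 drift_sum) => m nm.
  by apply: Hn0 => //; exact: leq_trans nm.
have h2 m : \sum_(0 <= i < K m) `|G (c m i) - S (c m i)| <= eps / 5.
  by apply: sG; [move=> i; exact: (measurable_cell HF)|exact: trivIset_fibers].
have h4 := h2 n.
rewrite -(sum_div_level HF n (fun i => `|G (c n i) - S (c n i)|)) in h4.
rewrite -(sum_div_level HF n (fun i => `|_ *: x n i - G (c n i)|)) in h5.
exists n; have -> : eps = eps / 5 + eps / 5 + eps / 5 + eps / 5 + eps / 5 by field.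
apply: le_trans (lerD (lerD (lerD (lerD h1 (h2 n.+1)) h3) h4) h5).
rewrite -!big_split/=; apply: ler_sum => j _.
have nrm (a : R) (v : X) : 0 <= a -> a * `|v| = `|a *: v|.
  by move=> a0; rewrite normrZ ger0_norm.
rewrite !nrm ?invr_ge0// !scalerBr scalerA -invfM -natrM mulnC -(levelS HF).
set a1 := _ *: x n.+1 j; set a6 := _ *: x n _; set a2 := G (c n.+1 j).
set a3 := S (c n.+1 j); set a5 := _ *: G _; set a4 := _ *: S _.
rewrite [`|a6 - a5|]distrC [`|a5 - a4|]distrC.
apply: le_trans (ler_distD a5 _ _) _; rewrite lerD2r.
apply: le_trans (ler_distD a4 _ _) _; rewrite lerD2r.
apply: le_trans (ler_distD a3 _ _) _; rewrite lerD2r.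
exact: ler_distD.
Qed.

End increments.

(** * Digits of a real number *)

Section digits.
Context {R : realType} (K : nat -> nat).

(* The points outside [0, 1), which have measure zero below, get the digit [0]. *)
Definition digit n (t : R) : nat :=
  if (0 <= t < 1)%R then Num.truncn ((K n)%:R * t) else 0.

(* The sigma-algebra generated by the cells, so that there is no need to show
   that the cells generate the Borel sets (which fails if [K] is bounded). *)
Definition digit_space := g_sigma_algebraType (cells digit).

Definition unit_measure : {measure set (measurableTypeR R) -> \bar R} :=
  mrestr (@lebesgue_measure R) (measurable_itv `[0%R, 1%R[).

Definition digit_measure (A : set digit_space) : \bar R := unit_measure A.

Hypothesis K0 : forall n, (0 < K n)%N.

Lemma unit_cell n i : (i < K n)%N ->
  cell digit n i `&` `[0, 1[%classic = [set` `[i%:R / (K n)%:R, i.+1%:R / (K n)%:R[].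
Proof.
have Kn : 0 < (K n)%:R :> R by rewrite ltr0n.
move=> iK; apply/seteqP; split => t /=; rewrite !in_itv/=.
  move=> [+ t01]; rewrite /cell/= /digit t01 => tE.
  have t0 : 0 <= (K n)%:R * t by rewrite mulr_ge0//; case/andP : t01.
  have := truncn_itv t0; rewrite tE => /andP[h1 h2].
  by rewrite ler_pdivrMr// ltr_pdivlMr// mulrC h1 h2.
rewrite ler_pdivrMr// ltr_pdivlMr// mulrC => /andP[h1 h2].
have t01 : 0 <= t < 1.
  rewrite -(pmulr_rge0 _ Kn) (le_trans _ h1)//= -(ltr_pM2l Kn) mulr1.
  by apply: lt_le_trans h2 _; rewrite ler_nat.
split => //; rewrite /cell /= /digit t01; apply: truncn_def.
by rewrite h1 h2.
Qed.

Lemma measurable_digit_cell n i :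
  @measurable _ (measurableTypeR R) (cell digit n i).
Proof.
have m01 : @measurable _ (measurableTypeR R) `[0, 1[%classic by exact: measurable_itv.
rewrite -(setUIDK (cell digit n i) `[0, 1[%classic); apply: measurableU.
  have [iK|iK] := ltnP i (K n); first by rewrite unit_cell//; exact: measurable_itv.
  rewrite (_ : _ `&` _ = set0); first exact: measurable0.
  apply/seteqP; split => // t [/=]; rewrite in_itv/= => + t01.
  have Kn : 0 < (K n)%:R :> R by rewrite ltr0n.
  rewrite /cell/= /digit t01 => tE.
  have t0 : 0 <= (K n)%:R * t by rewrite mulr_ge0//; case/andP : t01.
  have := truncn_itv t0; rewrite tE => /andP[+ _].
  apply/negP; rewrite -ltNge; case/andP : t01 => _ t1.
  by rewrite (@lt_le_trans _ _ (K n)%:R) ?ler_nat// gtr_pMr.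
(* Outside [[0, 1)] the digit is [0], so cell [0] contains this whole complement and the other cells
   do not meet it. *)
have [->|i0] := eqVneq i 0%N.
  rewrite (_ : _ `\` _ = ~` `[0, 1[%classic); first exact: measurableC.
  apply/seteqP; split => [t []//|t /= t01]; split => //.
  by move: t01; rewrite in_itv/= /cell/= /digit => /negP/negPf ->.
rewrite (_ : _ `\` _ = set0); first exact: measurable0.
apply/seteqP; split => // t [/=]; rewrite in_itv/= => + /negP/negPf t01.
by rewrite /cell/= /digit t01 => /esym/eqP; rewrite (negPf i0).
Qed.

Lemma measurable_digit_space (A : set digit_space) : measurable A ->
  @measurable _ (measurableTypeR R) A.
Proof.
apply: smallest_sub; first exact: sigma_algebra_measurable.
by move=> _ [->|[n [i ->]]]; [exact: measurable0|exact: measurable_digit_cell].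
Qed.

Let digit_measure0 : digit_measure set0 = 0%E.
Proof. exact: measure0. Qed.

Let digit_measure_ge0 A : (0 <= digit_measure A)%E.
Proof. exact: measure_ge0. Qed.

Let digit_measure_sigma_additive : semi_sigma_additive digit_measure.
Proof.
move=> F mF tF mU; apply: (@measure_semi_sigma_additive _ _ _ unit_measure F) => //.
  by move=> i; exact: measurable_digit_space.
exact: measurable_digit_space.
Qed.

HB.instance Definition _ := isMeasure.Build _ _ _ digit_measure
  digit_measure0 digit_measure_ge0 digit_measure_sigma_additive.

Let digit_measure_fin : fin_num_fun digit_measure.
Proof.
move=> A mA; rewrite ge0_fin_numE//.
apply: (@le_lt_trans _ _ (@lebesgue_measure R `[0%R, 1%R[%classic)); last first.
  by rewrite lebesgue_measure_itv/= lte_fin ltr01 oppr0 adde0 ltry.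
rewrite /digit_measure /= /mrestr; apply: le_measure; last exact: subIsetr.
  rewrite inE; apply: measurableI; last exact: measurable_itv.
  exact: measurable_digit_space.
by rewrite inE; exact: measurable_itv.
Qed.

HB.instance Definition _ := Measure_isFinite.Build _ _ _ digit_measure
  digit_measure_fin.

(** Cells are the intervals of length [1 / K n]. The levels are compatible because the integer part
    of [K n * t] is the quotient by [N n] of the integer part of [K n.+1 * t]. *)
Lemma digit_filtration (N : nat -> nat) :
  K 0 = 1%N -> (forall n, (0 < N n)%N) -> (forall n, K n.+1 = (K n * N n)%N) ->
  exists (d : measure_display) (T : measurableType d)
    (mu : {finite_measure set T -> \bar R}) (xi : nat -> T -> nat),
    cell_filtration mu K N xi.
Proof.
move=> K1 N0 KS; exists _, digit_space, digit_measure, digit; split => //.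
- move=> n t; rewrite /digit; case: ifP => // /andP[t0 t1].
  have := truncn_itv (mulr_ge0 (ler0n R (K n)) t0) => /andP[h _].
  rewrite -(ltr_nat R); apply: le_lt_trans h _.
  by rewrite gtr_pMr// ltr0n.
- move=> n t; rewrite /digit; case: ifP => [/andP[t0 t1]|_]; last by rewrite div0n.
  apply: truncn_def.
  have := truncn_itv (mulr_ge0 (ler0n R (K n.+1)) t0).
  set m := Num.truncn _ => /andP[h1 h2].
  have Nn : 0 < (N n)%:R :> R by rewrite ltr0n.
  rewrite -(ler_pM2l Nn) -(ltr_pM2l Nn) mulrA -!natrM [(N n * K n)%N]mulnC -KS.
  apply/andP; split.
    by apply: le_trans h1; rewrite ler_nat mulnC leq_trunc_div.
  by apply: lt_le_trans h2 _; rewrite ler_nat mulnC ltn_ceil.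
- move=> n i iK; have Kn : 0 < (K n)%:R :> R by rewrite ltr0n.
  rewrite /= /digit_measure /= /mrestr unit_cell//.
  rewrite lebesgue_measure_itv/= lte_fin ltr_pM2r ?invr_gt0// ltr_nat ltnSn.
  by rewrite -EFinB -mulrBl -natrB// subSnn mul1r.
Qed.

End digits.

(** * Hahn-Banach and Mazur-Orlicz *)

Section scalar.
Context {R : realType} {V : lmodType R} (y : V -> R) (ys : scalar y).

Lemma scalarD u v : y (u + v) = y u + y v.
Proof. by rewrite -{1}[u]scale1r ys mul1r. Qed.

Lemma scalar0 : y 0 = 0.
Proof. by have := scalarD 0 0; rewrite addr0; lra. Qed.

Lemma scalarZ a u : y (a *: u) = a * y u.
Proof. by rewrite -[a *: u]addr0 ys scalar0 addr0. Qed.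

Lemma scalarN u : y (- u) = - y u.
Proof. by rewrite -scaleN1r scalarZ mulN1r. Qed.

End scalar.

Section hahn_banach.
Context {R : realType} {V : lmodType R}.
Implicit Types (q : V -> R) (u v : V).

(** Homogeneity is an inequality here, which passes easily to infima; applying it to [a] and its
    inverse gives the equality, [sublinearZ]. *)
Definition sublinear q := (forall u v, q (u + v) <= q u + q v) /\
  (forall a v, 0 < a -> q (a *: v) <= a * q v).

Lemma sublinearZ q a v : sublinear q -> 0 <= a -> q (a *: v) = a * q v.
Proof.
move=> [_ qZ]; rewrite le_eqVlt => /orP[/eqP <-|a0].
  rewrite scale0r mul0r; apply/eqP; rewrite eq_le.
  have h1 := qZ 2 0 (ltr0n _ 2); have h2 := qZ 2^-1 0; rewrite invr_gt0 in h2.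
  by have {}h2 := h2 (ltr0n _ 2); rewrite !scaler0 in h1 h2; apply/andP; split; lra.
apply/eqP; rewrite eq_le qZ//= -ler_pdivlMl//.
by apply: le_trans (qZ _ _ _); rewrite ?invr_gt0// scalerA mulVf ?scale1r// gt_eqF.
Qed.

Lemma sublinearN q v : sublinear q -> - q (- v) <= q v.
Proof.
move=> qs; rewrite lerNl -subr_ge0 opprK.
have q0 : q 0 = 0 by rewrite -(scale0r 0) sublinearZ// mul0r.
by rewrite -q0 -(addNr v); exact: qs.1.
Qed.

(** The pointwise infimum of the family, kept finite by [L]. It provides lower bounds of chains, the
    competitor of a minimal functional, and the functional of the Mazur-Orlicz theorem. *)
Lemma inf_sublinear (I : Type) (i0 : I) (F : I -> V -> R) (L : V -> R) :
  (forall i v, L v <= F i v) ->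
  (forall i j u v, exists k, F k (u + v) <= F i u + F j v) ->
  (forall i a v, 0 < a -> exists k, F k (a *: v) <= a * F i v) ->
  exists2 q, sublinear q & forall i v, q v <= F i v.
Proof.
move=> FL FD FZ; pose q v := inf [set F i v | i in setT].
have qF i v : q v <= F i v.
  by apply: ge_inf; [exists (L v) => _ [j _ <-]|exists i].
have lbq v r : (forall i, r <= F i v) -> r <= q v.
  by move=> h; apply: lb_le_inf; [exists (F i0 v); exists i0|move=> _ [i _ <-]].
exists q => //; split => [u v|a v a0].
  rewrite -lerBlDr; apply: (lbq _ _) => i; rewrite lerBlDl -lerBlDr; apply: (lbq _ _) => j.
  have [k hk] := FD i j u v; rewrite lerBlDl.
  by apply: le_trans hk; exact: qF.
rewrite -ler_pdivrMl//; apply: (lbq _ _) => i; rewrite ler_pdivrMl//.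
by have [k hk] := FZ i a v a0; apply: le_trans hk; exact: qF.
Qed.

(* A pointwise minimal sublinear functional [q] is linear: minimality forces
   [q v <= q (v + a *: x) - a * q x] for [0 <= a], hence [q (- x) <= - q x]. *)
Theorem hahn_banach q : sublinear q ->
  exists2 y : V -> R, scalar y & forall v, y v <= q v.
Proof.
move=> qs; pose T := {p : V -> R | sublinear p /\ forall v, p v <= q v}.
(* The order is reversed, so that the maximal element given by Zorn's lemma is a minimal
   functional. *)
pose le (s t : T) := `[< forall v, sval t v <= sval s v >].
have [||A tA|[p [ps pq]] pmin] := @ZL_preorder T (exist _ q (conj qs (fun=> lexx _))) le.
- by move=> t; apply/asboolP.
- move=> r s t /asboolP rs /asboolP st; apply/asboolP => v.
  exact: le_trans (rs v).
- have [[s0 As0]|A0] := pselect (exists s, A s); last first.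
    by exists (exist _ q (conj qs (fun=> lexx _))) => s As; exfalso; apply: A0; exists s.
  pose F (i : {s | A s}) := sval (sval i).
  have Fs i : sublinear (F i) by case: i => -[p [ps pq]] ?.
  have Fq i v : F i v <= q v by case: i => -[p [ps pq]] ?; exact: pq.
  (* A chain is bounded by its infimum, which is finite since a sublinear functional below [q] is at
     least [- q (- v)] at [v]. *)
  have [|||p ps pF] := @inf_sublinear _ (exist _ s0 As0) F (fun v => - q (- v)).
  + move=> i v; apply: le_trans (sublinearN v (Fs i)); rewrite lerN2; exact: Fq.
  + move=> i j u v; have [/asboolP h|/asboolP h] := tA _ _ (svalP i) (svalP j).
      exists j; apply: le_trans ((Fs j).1 u v) _; rewrite lerD2r; exact: h.
    exists i; apply: le_trans ((Fs i).1 u v) _; rewrite lerD2l; exact: h.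
  + by move=> i a v a0; exists i; exact: (Fs i).2.
  have pq v : p v <= q v by apply: le_trans (pF (exist _ s0 As0) v) (Fq _ _).
  exists (exist _ p (conj ps pq)) => s As; apply/asboolP => v /=.
  exact: (pF (exist _ s As)).
have pN x : p (- x) = - p x.
  apply/eqP; rewrite eq_le; apply/andP; split; last by rewrite lerNl; exact: sublinearN.
  pose F (a : {a : R | 0 <= a}) v := p (v + sval a *: x) - sval a * p x.
  pose nn a (a0 : 0 <= a) : {a : R | 0 <= a} := exist _ a a0.
  have [|||r rs rF] := @inf_sublinear _ (nn 0 (lexx 0)) F (fun v => - p (- v)).
  - move=> [a a0] v; rewrite /F/= lerBrDr -(sublinearZ x ps a0) addrC lerBlDr.
    apply: le_trans (ps.1 _ _); rewrite le_eqVlt; apply/orP; left; apply/eqP.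
    by congr p; rewrite addrAC subrr add0r.
  - move=> [a a0] [b b0] u v; exists (nn _ (addr_ge0 a0 b0)); rewrite /F/=.
    rewrite scalerDl addrACA; have := ps.1 (u + a *: x) (v + b *: x); lra.
  - move=> [b b0] a v a0; exists (nn _ (mulr_ge0 (ltW a0) b0)); rewrite /F/=.
    by rewrite -scalerA -scalerDr (sublinearZ _ ps (ltW a0)) mulrBr mulrA.
  have rp v : r v <= p v.
    have := rF (nn 0 (lexx 0)) v.
    by rewrite /F/= scale0r addr0 mul0r subr0.
  have rq v : r v <= q v by apply: le_trans (pq v).
  have /asboolP/= := pmin (exist _ r (conj rs rq)) (asboolT rp).
  move=> /(_ (- x)) h; apply: le_trans h _.
  have := rF (nn 1 ler01) (- x); rewrite /F/= scale1r addNr mul1r.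
  have -> : p 0 = 0 by rewrite -(scale0r 0) (sublinearZ _ ps)// mul0r.
  by rewrite sub0r.
have pD u v : p (u + v) = p u + p v.
  apply/eqP; rewrite eq_le ps.1/=.
  have := ps.1 (- u) (- v); rewrite -opprD !pN; lra.
exists p => // a u v; rewrite pD; congr (_ + _).
have [a0|a0] := leP 0 a; first exact: sublinearZ.
rewrite -[a in LHS]opprK scaleNr pN sublinearZ ?mulNr ?opprK//.
by rewrite oppr_ge0 ltW.
Qed.

End hahn_banach.

Section mazur_orlicz.
Context {R : realType} {X : normedModType R}.
Variables (Z : eqType) (Q : Z -> Prop) (u : Z -> X) (b : Z -> R) (e : R).
Hypotheses (e0 : 0 <= e) (bu : forall l : seq Z, (forall z, z \in l -> Q z) ->
  \sum_(z <- l) b z <= e * `|\sum_(z <- l) u z|).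

Let weighted (l : seq (R * Z)) := forall p, p \in l -> 0 <= p.1 /\ Q p.2.

Lemma weighted_sum_le (l : seq (R * Z)) : weighted l ->
  \sum_(p <- l) p.1 * b p.2 <= e * `|\sum_(p <- l) p.1 *: u p.2|.
Proof.
move=> wl; set sb := \sum_(_ <- _) _; set su := \sum_(_ <- _) _.
(* The weights, multiplied by a large [n], are rounded down to integers, at a
   cost [M] that does not depend on [n]. *)
pose M := \sum_(p <- l) `|b p.2| + e * \sum_(p <- l) `|u p.2|.
have nM (n : nat) : n%:R * (sb - e * `|su|) <= M.
  pose k (p : R * Z) := Num.truncn (n%:R * p.1).
  pose s := flatten [seq nseq (k p) p.2 | p <- l].
  have sE (V : nmodType) (f : Z -> V) :
      \sum_(z <- s) f z = \sum_(p <- l) f p.2 *+ k p.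
    rewrite /s; elim: (l) => [|p l' IH] /=; first by rewrite !big_nil.
    by rewrite big_cat big_cons /= IH big_nseq iter_addr_0.
  have sQ z : z \in s -> Q z.
    move=> /flatten_mapP[p pl]; rewrite mem_nseq => /andP[_ /eqP ->].
    by case: (wl p pl).
  have frac p : p \in l -> 0 <= n%:R * p.1 - (k p)%:R <= 1.
    move=> /wl[p0 _]; have /andP[] := truncn_itv (mulr_ge0 (ler0n R n) p0).
    rewrite -/(k p) -natr1 => h1 h2; lra.
  have := bu sQ; rewrite !sE => h.
  have hb : n%:R * sb <= \sum_(p <- l) b p.2 *+ k p + \sum_(p <- l) `|b p.2|.
    rewrite mulr_sumr -big_split/= big_seq [leRHS]big_seq.
    apply: ler_sum => p /frac/andP[f0 f1].
    rewrite mulrA -lerBlDl -[b p.2 *+ _]mulr_natl -mulrBl; apply: le_trans (ler_norm _) _.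
    by rewrite normrM ger0_norm// ler_piMl.
  have hu : `|\sum_(p <- l) u p.2 *+ k p| <= n%:R * `|su| + \sum_(p <- l) `|u p.2|.
    rewrite -[n%:R](ger0_norm (ler0n R n)) -normrZ -lerBlDl.
    apply: le_trans (lerB_dist _ _) _; rewrite scaler_sumr -sumrB.
    apply: le_trans (ler_norm_sum _ _ _) _; rewrite big_seq [leRHS]big_seq.
    apply: ler_sum => p /frac/andP[f0 f1].
    rewrite distrC scalerA -[u p.2 *+ _]scaler_nat -scalerBl normrZ ger0_norm//.
    by rewrite ler_piMl.
  have {}hu := ler_wpM2l e0 hu; rewrite /M; lra.
rewrite leNgt -subr_gt0; apply/negP => c0.
have M0 : 0 <= M by rewrite addr_ge0 ?mulr_ge0 ?sumr_ge0.
have := nM (Num.truncn (M / (sb - e * `|su|))).+1.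
by apply/negP; rewrite -ltNge -ltr_pdivrMr// truncnS_gt.
Qed.

Theorem mazur_orlicz : exists y : X -> R,
  [/\ scalar y, forall v, `|y v| <= e * `|v| & forall z, Q z -> b z <= y (u z)].
Proof.
pose F (l : {l | weighted l}) v :=
  e * `|v + \sum_(p <- sval l) p.1 *: u p.2| - \sum_(p <- sval l) p.1 * b p.2.
have w0 : weighted [::] by [].
pose l0 : {l | weighted l} := exist _ [::] w0.
have [|||q qs qF] := @inf_sublinear _ _ _ l0 F (fun v => - (e * `|v|)).
- move=> [l wl] v; rewrite /F/= lerNl opprB.
  apply: le_trans (_ : e * `|\sum_(p <- l) p.1 *: u p.2| - _ <= _).
    by rewrite lerB// weighted_sum_le.
  rewrite -mulrBr ler_wpM2l//; apply: le_trans (lerB_dist _ _) _.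
  by rewrite opprD addrCA subrr addr0 normrN.
- move=> [l wl] [l' wl'] v v'.
  have wll : weighted (l ++ l') by move=> p; rewrite mem_cat => /orP[/wl|/wl'].
  exists (exist _ _ wll); rewrite /F/= !big_cat/= addrACA.
  have := ler_wpM2l e0 (ler_normD (v + \sum_(p <- l) p.1 *: u p.2)
    (v' + \sum_(p <- l') p.1 *: u p.2)).
  lra.
- move=> [l wl] a v a0.
  have wal : weighted [seq (a * p.1, p.2) | p <- l].
    move=> _ /mapP[p /wl[p0 Qp] ->] /=; split => //.
    by rewrite mulr_ge0// ltW.
  exists (exist _ _ wal); rewrite /F/= !big_map/=.
  under eq_bigr do rewrite -scalerA.
  under [X in _ - X]eq_bigr do rewrite -mulrA.
  rewrite -scaler_sumr -mulr_sumr -scalerDr normrZ gtr0_norm//.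
  by rewrite mulrBr mulrCA.
have [y yl yq] := hahn_banach qs; exists y.
have y_le v : y v <= e * `|v|.
  apply: le_trans (yq v) _; have := qF l0 v.
  by rewrite /F/= !big_nil addr0 subr0.
have yN := scalarN yl.
split => // [v|z Qz].
  rewrite ler_norml y_le andbT lerNl -yN.
  by rewrite (le_trans (y_le _))// normrN.
(* At [- u z], the list with the single point [z] and weight 1 gives [y (- u z) <= - b z]. *)
have wz : weighted [:: (1, z)] by move=> p; rewrite inE => /eqP ->.
have := le_trans (yq (- u z)) (qF (exist _ _ wz) (- u z)).
rewrite /F/= !big_cons !big_nil !addr0 scale1r addNr normr0 mulr0 sub0r mul1r.
by rewrite yN lerN2.
Qed.

End mazur_orlicz.

(** * Slices *)

Lemma sum_nth_mod (V : nmodType) (X : Type) (x0 : X) (h : X -> V) (s : seq X) (q : nat) :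
  \sum_(0 <= l < q * size s) h (nth x0 s (l %% size s)) = (\sum_(z <- s) h z) *+ q.
Proof.
rewrite sum_nat_mul (eq_bigr (fun=> \sum_(z <- s) h z)).
  by rewrite sumr_const_nat subn0.
move=> i _; rewrite (big_nth x0); apply: eq_big_nat => l ls.
by rewrite modnMDl modn_small.
Qed.

Section slices.
Context {R : realType} {X : completeNormedModType R}.
Variables (f : X -> R) (e d : R).
Hypothesis e0 : 0 < e.

Definition small_slice := exists (y : X -> R) (c : X) (a : R),
  [/\ scalar y, forall v, `|y v| <= e * `|v|, `|c| <= 1, 0 < a &
      forall z, `|z| <= 1 -> d <= `|z - c| -> f z + y z + a <= f c + y c].

Hypothesis nslice : ~ small_slice.

(** Otherwise the Mazur-Orlicz theorem applies to the points of the ball far from [x], and the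
    opposite of the functional found there defines a small slice with centre [x] and gap [r]. *)
Lemma far_average (x : X) (r : R) : `|x| <= 1 -> 0 < r ->
  exists l : seq X, [/\ (0 < size l)%N,
    forall z, z \in l -> `|z| <= 1 /\ d <= `|z - x| &
    e * `|\sum_(z <- l) (z - x)| <= \sum_(z <- l) (f z - f x + r)].
Proof.
move=> x1 r0; apply: contrapT => nl; apply: nslice.
have [|l lQ|y [ys ye yb]] := @mazur_orlicz R X X (fun z => `|z| <= 1 /\ d <= `|z - x|)
    (fun z => z - x) (fun z => f z - f x + r) e.
- exact: ltW.
- rewrite leNgt; apply/negP => lt; apply: nl; exists l; split => //; last exact: ltW.
  by case: l lt {lQ} => //; rewrite !big_nil normr0 mulr0 ltxx.
exists (fun v => - y v), x, r; split => //.
- by move=> a u v; rewrite ys opprD mulrN.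
- by move=> v; rewrite normrN.
move=> z z1 zx; have := yb z (conj z1 zx).
rewrite (scalarD ys) (scalarN ys); lra.
Qed.

Lemma next_level (K : nat) (x : nat -> X) (r : R) :
  (forall i, `|x i| <= 1) -> 0 < r ->
  exists N (x' : nat -> X), [/\ (0 < N)%N, forall j, `|x' j| <= 1,
    forall j, d <= `|x' j - x (j %/ N)%N| &
    forall i, (i < K)%N -> e * `|\sum_(0 <= l < N) (x' (i * N + l)%N - x i)| <=
      \sum_(0 <= l < N) (f (x' (i * N + l)%N) - f (x i) + r)].
Proof.
move=> x1 r0; have [L LP] := choice (fun i => far_average (x1 i) r0).
have L0 i : (0 < size (L i))%N by case: (LP i).
(* Each list is repeated, so that all cells have the same number of children. *)
pose N := (\prod_(i < K) size (L i))%N.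
pose x' j := let s := L (j %/ N)%N in nth 0 s ((j %% N) %% size s).
have x'P j : `|x' j| <= 1 /\ d <= `|x' j - x (j %/ N)%N|.
  have [_ + _] := LP (j %/ N)%N; apply.
  by rewrite mem_nth// ltn_mod.
have N0 : (0 < N)%N by rewrite prodn_gt0.
exists N, x'; split => //; try by move=> j; case: (x'P j).
move=> i iK; have [_ _ h] := LP i.
have [q Nq] : exists q, N = (q * size (L i))%N.
  exists (\prod_(j < K | j != Ordinal iK) size (L j))%N.
  by rewrite mulnC /N (bigD1 (Ordinal iK)).
have sE (V : nmodType) (h' : X -> V) :
    \sum_(0 <= l < N) h' (x' (i * N + l)%N) = (\sum_(z <- L i) h' z) *+ q.
  rewrite -(sum_nth_mod 0) -Nq; apply: eq_big_nat => l /andP[_ lN].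
  by rewrite /x' divnMDl// (divn_small lN) addn0 modnMDl (modn_small lN).
rewrite (sE _ (fun z => z - x i)) (sE _ (fun z => f z - f (x i) + r)).
by rewrite -scaler_nat normrZ normr_nat mulrCA -[leRHS]mulr_natl ler_wpM2l.
Qed.

End slices.

Theorem small_slice_exists (R : realType) (X : completeNormedModType R)
    (f : X -> R) (M e d : R) :
  radon_nikodym_property X -> (forall z, `|z| <= 1 -> `|f z| <= M) ->
  0 < e -> 0 < d -> small_slice f e d.
Proof.
move=> X_RNP fM e0 d0; apply: contrapT => nslice.
have r0 n : 0 < 2^-1 ^+ n :> R by rewrite exprn_gt0// invr_gt0.
(* [s] consists of a level, its number of cells and its values, [t] of the number of children and
   the next values. The bound on the values is a premise inside [valid], so that the choice function
   [g] is total. *)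
pose valid (s : nat * nat * (nat -> X)) (t : nat * (nat -> X)) :=
  (forall i, `|s.2 i| <= 1) -> [/\ (0 < t.1)%N, forall j, `|t.2 j| <= 1,
    forall j, d <= `|t.2 j - s.2 (j %/ t.1)%N| &
    forall i, (i < s.1.2)%N ->
      e * `|\sum_(0 <= l < t.1) (t.2 (i * t.1 + l)%N - s.2 i)| <=
      \sum_(0 <= l < t.1) (f (t.2 (i * t.1 + l)%N) - f (s.2 i) + 2^-1 ^+ s.1.1)].
have [g gP] : {g & forall s, valid s (g s)}.
  apply: choice => -[[n K] x].
  have [x1|x1] := pselect (forall i, `|x i| <= 1); last by exists (0, x).
  have [N [x' h]] := next_level e0 nslice K x1 (r0 n).
  by exists (N, x') => _.
pose st := fix st n : nat * (nat -> X) := if n is n'.+1 then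
  let s := st n' in let t := g (n', s.1, s.2) in ((s.1 * t.1)%N, t.2)
  else (1%N, fun=> 0).
pose K n := (st n).1; pose x n := (st n).2; pose N n := (g (n, K n, x n)).1.
have x1 n i : `|x n i| <= 1.
  elim: n i => [|n IH] i; first by rewrite normr0.
  by have [_ + _ _] := gP (n, K n, x n) IH; apply.
have N0 n : (0 < N n)%N by case: (gP (n, K n, x n) (x1 n)).
have far n j : d <= `|x n.+1 j - x n (j %/ N n)%N|.
  by have [_ _ + _] := gP (n, K n, x n) (x1 n); apply.
have gain n i : (i < K n)%N ->
    e * `|\sum_(0 <= l < N n) (x n.+1 (i * N n + l)%N - x n i)| <=
    \sum_(0 <= l < N n) (f (x n.+1 (i * N n + l)%N) - f (x n i) + 2^-1 ^+ n).
  by have [_ _ _ +] := gP (n, K n, x n) (x1 n); apply.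
have KS n : K n.+1 = (K n * N n)%N by [].
have K0 n : (0 < K n)%N by elim: n => // n IH; rewrite KS muln_gt0 IH N0.
have Kr n : 0 < (K n)%:R :> R by rewrite ltr0n.
have Nr n : 0 < (N n)%:R :> R by rewrite ltr0n.
(* The mean of [f] along the process at time [n]; its increments control the drift. *)
pose F n := \sum_(0 <= i < K n) (K n)%:R^-1 * f (x n i).
have drift_le n : e * drift K N x n <= F n.+1 - F n + 2^-1 ^+ n.
  have -> : F n.+1 - F n + 2^-1 ^+ n = \sum_(0 <= i < K n) (K n.+1)%:R^-1 *
      \sum_(0 <= l < N n) (f (x n.+1 (i * N n + l)%N) - f (x n i) + 2^-1 ^+ n).
    rewrite /F [in LHS]KS sum_nat_mul -KS.
    have {1}-> : 2^-1 ^+ n = \sum_(0 <= i < K n) (K n)%:R^-1 * 2^-1 ^+ n :> R.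
      rewrite sumr_const_nat subn0 -[RHS]mulr_natl mulrA divff ?mul1r//.
      by rewrite gt_eqF.
    rewrite -sumrB -big_split/=; apply: eq_bigr => i _.
    rewrite big_split/= sumrB !sumr_const_nat !subn0.
    rewrite -[f (x n i) *+ _]mulr_natl -[2^-1 ^+ n *+ _]mulr_natl.
    rewrite -mulr_sumr KS natrM; field.
    by apply/andP; split; [exact: (lt0r_neq0 (Nr n))|exact: (lt0r_neq0 (Kr n))].
  rewrite /drift mulr_sumr big_nat [leRHS]big_nat; apply: ler_sum => i /andP[_ iK].
  apply: le_trans (ler_wpM2l _ (gain _ _ iK)); last by rewrite invr_ge0.
  rewrite /child_mean KS natrM invfM mulrCA -[leRHS]mulrA ler_wpM2l ?invr_ge0//.
  rewrite mulrCA ler_wpM2l//; first exact: ltW.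
  have nrm (v : X) : (N n)%:R^-1 * `|v| = `|(N n)%:R^-1 *: v|.
    by rewrite normrZ ger0_norm// invr_ge0.
  rewrite nrm sumrB sumr_const_nat subn0 scalerBr -[x n i *+ _]scaler_nat scalerA.
  by rewrite mulVf ?gt_eqF// scale1r distrC.
have FM n : `|F n| <= M.
  apply: le_trans (ler_norm_sum _ _ _) _.
  apply: (@le_trans _ _ (\sum_(0 <= i < K n) (K n)%:R^-1 * M)).
    apply: ler_sum => i _; rewrite normrM ger0_norm ?invr_ge0//.
    by rewrite ler_wpM2l ?invr_ge0//; exact: fM.
  rewrite sumr_const_nat subn0 -[leLHS]mulr_natl mulrA divff ?mul1r//.
  by rewrite gt_eqF.
(* The increments of [F] telescope to at most [2 * M], and the errors [2^-1 ^+ n] sum to at most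
   2. *)
have drift_sum n : \sum_(0 <= k < n) drift K N x k <= e^-1 * (2 * M + 2).
  rewrite ler_pdivlMl//.
  have : e * \sum_(0 <= k < n) drift K N x k <= F n - F 0 + (2 - 2 * 2^-1 ^+ n).
    elim: n => [|n IH]; first by rewrite big_geq// expr0; lra.
    by rewrite big_nat_recr//= mulrDr exprS; have := drift_le n; lra.
  have := r0 n; have := FM n; have := FM 0%N; rewrite !ler_norml; lra.
have [dd [T [mu [xi HF]]]] := digit_filtration (R := R) K0 erefl N0 KS.
(* All increments are at least [d] and the weights sum to 1, so a mean of at most [d / 2] is
   impossible. *)
have d2 : 0 < d / 2 by rewrite divr_gt0.
have [n] := rnp_increment_small X_RNP HF x1 drift_sum d2.
apply/negP; rewrite -ltNge; apply: (@lt_le_trans _ _ d).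
  by rewrite ltr_pdivrMr// ltr_pMr// ltr1n.
have {1}-> : d = \sum_(0 <= j < K n.+1) (K n.+1)%:R^-1 * d.
  rewrite sumr_const_nat subn0 -[RHS]mulr_natl mulrA divff ?mul1r//.
  by rewrite gt_eqF.
by apply: ler_sum => j _; rewrite ler_wpM2l ?invr_ge0.
Qed.

(** * Maxima of perturbed functions *)

Lemma lipschitz_continuous (R : realType) (X : normedModType R) (f : X -> R) (L : R) :
  (forall u v, `|f u - f v| <= L * `|u - v|) -> continuous f.
Proof.
move=> fL v; apply/cvgrPdist_le => r r0.
have L0 : 0 < `|L| + 1 by rewrite ltr_wpDl.
near=> u; apply: le_trans (fL v u) _.
apply: (@le_trans _ _ ((`|L| + 1) * `|v - u|)).
  by rewrite ler_wpM2r// (le_trans (ler_norm _))// lerDl.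
rewrite -ler_pdivlMl//; near: u.
apply/nbhs_normP; exists ((`|L| + 1)^-1 * r); first by rewrite /= mulr_gt0 ?invr_gt0.
by move=> u /ltW.
Unshelve. all: by end_near. Qed.

(** If [c m] and [c n] were far apart, each would have a strictly larger value than the other; so
    [c] is Cauchy. A point other than the limit is eventually far from [c n], hence has a smaller
    value than [c n]. *)
Lemma max_of_strict_slices (R : realType) (X : completeNormedModType R)
    (f : X -> R) (c : nat -> X) : continuous f -> (forall n, `|c n| <= 1) ->
  (forall n z, `|z| <= 1 -> 2^-1 ^+ n <= `|z - c n| -> f z < f (c n)) ->
  exists2 z0, `|z0| <= 1 & forall z, `|z| <= 1 -> f z <= f z0.
Proof.
move=> fC c1 fc; have r0 n : 0 < 2^-1 ^+ n :> R by rewrite exprn_gt0// invr_gt0.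
have rle n m : (n <= m)%N -> 2^-1 ^+ m <= 2^-1 ^+ n :> R.
  by move=> nm; apply: ler_wiXn2l => //; rewrite invf_le1// ler1n.
have r_small (r : R) : 0 < r -> exists n, 2^-1 ^+ n <= r.
  move=> rpos; have /cvgrPdist_le/(_ r rpos)[n _ /(_ n (leqnn n))] :
      (fun n => 2^-1 ^+ n : R) @ \oo --> 0.
    by apply: cvg_expr; rewrite ger0_norm ?invr_ge0// invf_lt1// ltr1n.
  by rewrite /= sub0r normrN (ger0_norm (ltW (r0 n))) => h; exists n.
have cc n m : (n <= m)%N -> `|c m - c n| < 2^-1 ^+ n.
  move=> nm; rewrite ltNge; apply/negP => h.
  have h1 := fc n _ (c1 m) h; rewrite distrC in h.
  by have := fc m _ (c1 n) (le_trans (rle _ _ nm) h); rewrite ltNge (ltW h1).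
have : cvgn c.
  apply: cvgn_of_cauchy => r rpos.
  have [n hn] := r_small (r / 2) (divr_gt0 rpos (ltr0n _ 2)).
  exists ([set m | (n <= m)%N], [set m | (n <= m)%N]); first by split; exists n.
  move=> [p q] [/= np nq]; apply: le_trans (ler_distD (c n) _ _) _.
  by rewrite (splitr r) lerD// ltW// ?[`|c n - _|]distrC (lt_le_trans (cc _ _ _)).
set z0 := lim (c @ \oo) => cz0; exists z0.
  by apply: cvgr_to_le (cvg_norm cz0) _; near=> n.
move=> z z1; have [->//|zz0] := eqVneq z z0.
have d0 : 0 < `|z - z0| / 2 by rewrite divr_gt0// normr_gt0 subr_eq0.
have [n1 hn1] := r_small _ d0.
have fcz : f (c n) @[n --> \oo] --> f z0 by apply: continuous_cvg => //; exact: fC.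
apply: cvgr_to_ge fcz _; near=> n.
apply/ltW/fc => //; apply: (@le_trans _ _ (`|z - z0| / 2)).
  by apply: le_trans hn1; apply: rle; near: n; exists n1.
rewrite -(lerD2r (`|z0 - c n|)).
have : `|z0 - c n| <= `|z - z0| / 2 by near: n; move/cvgrPdist_le : cz0; apply.
have := ler_distD (c n) z z0; rewrite [`|c n - z0|]distrC; lra.
Unshelve. all: by end_near. Qed.

(** An instance of Stegall's variational principle on the unit ball. *)
Theorem linear_perturbation_max (R : realType) (X : completeNormedModType R)
    (p : X -> R) (L e : R) : radon_nikodym_property X ->
  (forall u v, `|p u - p v| <= L * `|u - v|) -> 0 < e ->
  exists y : X -> R, [/\ scalar y, forall v, `|y v| <= e * `|v| &
    exists2 z0, `|z0| <= 1 & forall z, `|z| <= 1 -> p z + y z <= p z0 + y z0].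
Proof.
move=> X_RNP pL e_gt0.
have r0 n : 0 < 2^-1 ^+ n :> R by rewrite exprn_gt0// invr_gt0.
(* [s] holds the index, the functional accumulated so far and the norm allowed to the next one; [t]
   holds that next functional, the centre of its slice and the gap. *)
pose valid (s : nat * (X -> R) * R) (t : (X -> R) * X * R) :=
  scalar s.1.2 -> (exists C, forall v, `|s.1.2 v| <= C * `|v|) -> 0 < s.2 ->
  [/\ scalar t.1.1, forall v, `|t.1.1 v| <= s.2 * `|v|, `|t.1.2| <= 1, 0 < t.2 &
    forall z, `|z| <= 1 -> 2^-1 ^+ s.1.1 <= `|z - t.1.2| ->
      p z + s.1.2 z + t.1.1 z + t.2 <= p t.1.2 + s.1.2 t.1.2 + t.1.1 t.1.2].
have [g gP] : {g & forall s, valid s (g s)}.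
  apply: choice => -[[n Y] r].
  have [[Ys [C YC] rpos]|nv] := pselect
      [/\ scalar Y, exists C, forall v, `|Y v| <= C * `|v| & 0 < r]; last first.
    by exists (Y, 0, r) => Ys YC rpos; exfalso; exact: nv.
  have pYM z : `|z| <= 1 -> `|p z + Y z| <= `|p 0| + `|L| + `|C|.
    move=> z1; apply: le_trans (ler_normD _ _) _; apply: lerD.
      rewrite -[p z](subrK (p 0)) addrC; apply: le_trans (ler_normD _ _) _.
      rewrite lerD2l; apply: le_trans (pL _ _) _; rewrite subr0.
      by apply: le_trans (ler_wpM2r (normr_ge0 _) (ler_norm _)) _; rewrite ler_piMr.
    apply: le_trans (YC _) _.
    by apply: le_trans (ler_wpM2r (normr_ge0 _) (ler_norm _)) _; rewrite ler_piMr.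
  have [y [c [a [ys ye c1 a0 ysl]]]] := small_slice_exists X_RNP pYM rpos (r0 n).
  by exists (y, c, a) => _ _ _; split.
(* [E n] bounds the norm of the [n]-th functional, so all the functionals from
   the [n]-th on contribute at most [2 * E n]; the bound [8 * E n.+1 <= gap]
   makes the [n]-th slice inequality survive, strictly, in the limit. *)
pose st := fix st n : (X -> R) * R := if n is n'.+1 then
  let s := st n' in let t := g (n', s.1, s.2) in
    (fun v => s.1 v + t.1.1 v, Num.min (s.2 / 2) (t.2 / 8))
  else (fun=> 0, e / 2).
pose Y n := (st n).1; pose E n := (st n).2.
pose t n := g (n, Y n, E n).
have YS n v : Y n.+1 v = Y n v + (t n).1.1 v by [].
have ES n : E n.+1 = Num.min (E n / 2) ((t n).2 / 8) by [].
have st_valid n : [/\ scalar (Y n), exists C, forall v, `|Y n v| <= C * `|v| & 0 < E n].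
  elim: n => [|n [Ys [C YC] E0]].
    split; [by move=> a u v; rewrite mulr0 addr0|exists 0 => v|by rewrite divr_gt0].
    by rewrite normr0 mul0r.
  have [ts tE c1 a0 _] := gP (n, Y n, E n) Ys (ex_intro _ C YC) E0; split.
  - by move=> a u v; rewrite !YS Ys ts mulrDr addrACA.
  - exists (C + E n) => v; rewrite mulrDl; apply: le_trans (ler_normD _ _) _.
    by apply: lerD; [exact: YC|exact: tE].
  - by rewrite ES lt_min !divr_gt0.
have tP n : [/\ forall v, `|(t n).1.1 v| <= E n * `|v|, `|(t n).1.2| <= 1, 0 < (t n).2 &
    forall z, `|z| <= 1 -> 2^-1 ^+ n <= `|z - (t n).1.2| ->
      p z + Y n.+1 z + (t n).2 <= p (t n).1.2 + Y n.+1 (t n).1.2].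
  have [Ys YC E0] := st_valid n; have [_ h1 h2 h3 h4] := gP (n, Y n, E n) Ys YC E0.
  split => // z z1 zc; have := h4 z z1 zc; by rewrite !YS -!addrA.
have E0 n : 0 < E n by case: (st_valid n).
have E2 n : 2 * E n.+1 <= E n.
  by rewrite -ler_pdivlMl// mulrC ES ge_min lexx.
have E8 n : 8 * E n.+1 <= (t n).2.
  by rewrite -ler_pdivlMl// mulrC ES ge_min lexx orbT.
(* Subtracting [2 * E m] lets the induction close, because [E] at least halves at each step. *)
have YE n m v : (n <= m)%N -> `|Y m v - Y n v| <= (2 * E n - 2 * E m) * `|v|.
  elim: m => [|m IH]; first by rewrite leqn0 => /eqP ->; rewrite !subrr normr0 mul0r.
  rewrite leq_eqVlt => /orP[/eqP ->|]; first by rewrite !subrr normr0 mul0r.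
  rewrite ltnS => /IH {}IH; have [h _ _ _] := tP m.
  have -> : Y m.+1 v - Y n v = (Y m v - Y n v) + (t m).1.1 v.
    by rewrite YS addrAC.
  apply: le_trans (ler_normD _ _) _; apply: le_trans (lerD IH (h v)) _.
  by rewrite -mulrDl ler_wpM2r//; have := E2 m; lra.
have YE2 n m v : (n <= m)%N -> `|Y m v - Y n v| <= 2 * E n * `|v|.
  by move=> /(YE _ _ v) h; apply: le_trans h _; rewrite ler_wpM2r//; have := E0 m; lra.
have Esmall (r : R) : 0 < r -> exists n, E n <= r.
  move=> rpos; have /cvgrPdist_le/(_ r rpos)[n _ /(_ n (leqnn n))] :
      (fun n => e / 2 * 2^-1 ^+ n : R) @ \oo --> 0.
    by apply: cvg_geometric; rewrite ger0_norm ?invr_ge0// invf_lt1// ltr1n.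
  rewrite /= sub0r normrN => /(le_trans (ler_norm _)) h; exists n.
  apply: le_trans h; elim: n => [|n IH]; first by rewrite expr0 mulr1.
  by have := E2 n; rewrite exprS; lra.
have Ycvg v : cvgn (fun n => Y n v).
  apply: (@cvgn_of_cauchy R R^o) => r rpos.
  have rv : 0 < r / (4 * (`|v| + 1)) by rewrite divr_gt0// mulr_gt0// ltr_wpDl.
  have [n hn] := Esmall _ rv.
  exists ([set m | (n <= m)%N], [set m | (n <= m)%N]); first by split; exists n.
  move=> [a b] [/= na nb]; apply: le_trans (ler_distD (Y n v) _ _) _.
  rewrite [`|Y n v - _|]distrC; have := YE2 n a v na; have := YE2 n b v nb.
  have : 4 * E n * `|v| <= r.
    apply: (@le_trans _ _ (4 * E n * (`|v| + 1))).
      by rewrite ler_wpM2l ?lerDl// mulr_ge0// ltW.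
    by move: hn; rewrite ler_pdivlMr ?mulr_gt0 ?ltr_wpDl// => hn; lra.
  lra.
pose y v := limn (fun n => Y n v).
have yl n v : `|y v - Y n v| <= 2 * E n * `|v|.
  apply: cvgr_to_le (cvg_norm (cvgB (Ycvg v) (cvg_cst (Y n v)))) _.
  by near=> m; apply: YE2; near: m; exists n.
have ys : scalar y.
  move=> a u v; apply: cvg_lim => //.
  rewrite (_ : (fun n => _) = fun n => a * Y n u + Y n v).
    by apply: cvgD; [apply: cvgM => //; exact: cvg_cst|].
  by apply/funext => n; have [-> _ _] := st_valid n.
have ye v : `|y v| <= e * `|v|.
  have e2 : 2 * E 0%N = e by rewrite /E /= mulrC divfK// pnatr_eq0.
  by have := yl 0%N v; rewrite subr0 e2.
exists y; split => //.
apply: (@max_of_strict_slices R X (fun v => p v + y v) (fun n => (t n).1.2)).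
- apply: (@lipschitz_continuous _ _ _ (L + e)) => u v.
  rewrite mulrDl opprD addrACA; apply: le_trans (ler_normD _ _) _.
  by apply: lerD => //; rewrite -(scalarN ys) -(scalarD ys).
- by move=> n; case: (tP n).
(* Replacing [Y n.+1] by [y] costs at most [2 * E n.+1] at each of the two points, in total at most
   half the gap. *)
- move=> n z z1 zc; have [_ c1 a0 h] := tP n; have {}h := h z z1 zc.
  have := yl n.+1 z; have := yl n.+1 (t n).1.2; rewrite !ler_distl.
  have := E8 n; have En := E0 n.+1.
  have hz : E n.+1 * `|z| <= E n.+1 by rewrite ler_piMr// ltW.
  have hc : E n.+1 * `|(t n).1.2| <= E n.+1 by rewrite ler_piMr// ltW.
  lra.
Unshelve. all: by end_near. Qed.

(** * Seminorms *)

Section seminorms.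
Context {R : realType} {X : normedModType R} (p : X -> R) (ps : seminorm p).

Lemma seminorm0 : p 0 = 0.
Proof. by rewrite -(scale0r 0) ps.2 normr0 mul0r. Qed.

Lemma seminormN v : p (- v) = p v.
Proof. by rewrite -scaleN1r ps.2 normrN1 mul1r. Qed.

Lemma seminorm_ge0 v : 0 <= p v.
Proof. by have := ps.1 v (- v); rewrite subrr seminorm0 seminormN; lra. Qed.

Lemma seminorm_dist u v : `|p u - p v| <= p (u - v).
Proof.
rewrite ler_norml; have := ps.1 (u - v) v; have := ps.1 (v - u) u.
by rewrite !subrK -[v - u]opprB seminormN; lra.
Qed.

Lemma seminorm_bounded : continuous p -> exists L, forall v, p v <= L * `|v|.
Proof.
move=> /(_ 0)/cvgrPdist_le/(_ 1 ltr01)/nbhs_normP[r /= r0 hr].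
exists (2 / r) => v; have [->|v0] := eqVneq v 0.
  by rewrite seminorm0 normr0 mulr0.
have nv : 0 < `|v| by rewrite normr_gt0.
(* Scaling [v] to norm [r / 2] puts it strictly inside the ball of radius [r], where [p] is at most
   1. *)
have a0 : 0 < r / 2 / `|v| by rewrite !divr_gt0.
have := hr (r / 2 / `|v| *: v).
rewrite /= !sub0r seminorm0 !sub0r !normrN normrZ ps.2 (gtr0_norm a0) divfK ?gt_eqF//.
rewrite (ger0_norm (mulr_ge0 (ltW a0) (seminorm_ge0 v))) => h.
have {}h := h (_ : r / 2 < r); rewrite ltr_pdivrMr// ltr_pMr// ltr1n in h.
have -> : 2 / r * `|v| = (r / 2 / `|v|)^-1 * 1.
  by field; rewrite !gt_eqF.
by rewrite ler_pdivlMl//; exact: h.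
Qed.

Lemma seminorm_unit_bound (z0 : X) :
  (forall z, `|z| <= 1 -> p z <= p z0) -> forall v, p v <= p z0 * `|v|.
Proof.
move=> pz0 v; have [->|v0] := eqVneq v 0; first by rewrite seminorm0 normr0 mulr0.
have nv : 0 < `|v| by rewrite normr_gt0.
have := pz0 (`|v|^-1 *: v).
rewrite normrZ ps.2 ger0_norm ?invr_ge0// mulVf ?gt_eqF// => /(_ (lexx 1)).
by rewrite ler_pdivrMl// mulrC.
Qed.

Lemma lip_norm_seminorm (z0 : X) : `|z0| = 1 ->
  (forall z, `|z| <= 1 -> p z <= p z0) -> lip_norm p = (p z0)%:E.
Proof.
move=> z01 pz0; apply/eqP; rewrite eq_le; apply/andP; split.
  apply: ge_ereal_sup => _ [u [v [uv ->]]]; rewrite lee_fin ler_pdivrMr.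
    exact: le_trans (seminorm_dist u v) (seminorm_unit_bound pz0 _).
  by rewrite normr_gt0 subr_eq0.
apply: ereal_sup_ubound; exists z0, 0; split.
  by rewrite -normr_eq0 z01 oner_eq0.
by rewrite seminorm0 !subr0 z01 divr1 ger0_norm// seminorm_ge0.
Qed.

(** Scaling [z1] up to the sphere does not decrease [p]. If [z1 = 0], then [p] vanishes on the ball
    and any unit vector serves. *)
Lemma norm_attaining_of_max (z1 : X) : (exists v : X, v != 0) -> `|z1| <= 1 ->
  (forall z, `|z| <= 1 -> p z <= p z1) -> norm_attaining p.
Proof.
move=> [v v0] z11 pz1.
have unit_vec (w : X) : w != 0 -> `| `|w|^-1 *: w| = 1.
  by move=> w0; rewrite normrZ ger0_norm ?invr_ge0// mulVf// normr_eq0.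
have [z0 z01 pz10] : exists2 z0 : X, `|z0| = 1 & p z1 <= p z0.
  have [z1E|z10] := eqVneq z1 0.
    exists (`|v|^-1 *: v); first exact: unit_vec.
    by rewrite z1E seminorm0 seminorm_ge0.
  exists (`|z1|^-1 *: z1); first exact: unit_vec.
  rewrite ps.2 ger0_norm ?invr_ge0// ler_peMl ?seminorm_ge0//.
  by rewrite invf_ge1// normr_gt0.
exists z0; split => //; rewrite (lip_norm_seminorm z01)// => z z1'.
exact: le_trans (pz1 z z1') pz10.
Qed.

End seminorms.

Theorem proposition3p6 (R : realType) (X : completeNormedModType R)
    (X_nontrivial : exists x : X, x != 0)
    (X_RNP : radon_nikodym_property X) :
  forall p : X -> R, Sem p ->
  forall eps : R, 0 < eps ->
  exists q : X -> R,
    [/\ Sem q, norm_attaining q & (lip_norm (fun x => p x - q x)%R < eps%:E)%E].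
Proof.
move=> p [ps pC] eps eps0; have [L pL] := seminorm_bounded ps pC.
have pLip u v : `|p u - p v| <= L * `|u - v|.
  exact: le_trans (seminorm_dist ps u v) (pL _).
(* Half of [eps], because the bound on [y] is not strict. *)
have e20 : 0 < eps / 2 by rewrite divr_gt0.
have [y [ys ye [z1 z11 pyz1]]] := linear_perturbation_max X_RNP pLip e20.
pose q v := p v + `|y v|.
have qs : seminorm q.
  split => [u v|a v]; rewrite /q.
    rewrite (scalarD ys) addrACA; apply: lerD; first exact: ps.1.
    exact: ler_normD.
  by rewrite (scalarZ ys) normrM ps.2 mulrDr.
exists q; split.
- split => //; apply: (lipschitz_continuous (L := L + eps / 2)) => u v.
  apply: le_trans (seminorm_dist qs u v) _.
  by rewrite mulrDl; apply: lerD.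
- apply: (norm_attaining_of_max qs X_nontrivial z11) => z z_le1.
  apply: (@le_trans _ _ (p z1 + y z1)); last by rewrite lerD2l ler_norm.
  (* Where [y z] is negative, the maximum is compared with the value at [- z], since [p] is even. *)
  rewrite /q; case: (ger0P (y z)) => _; first exact: pyz1.
  by rewrite -(seminormN ps) -(scalarN ys) pyz1// normrN.
apply: (@le_lt_trans _ _ (eps / 2)%:E); last first.
  by rewrite lte_fin ltr_pdivrMr// ltr_pMr// ltr1n.
apply: ge_ereal_sup => _ [u [v [uv ->]]]; rewrite lee_fin ler_pdivrMr; last first.
  by rewrite normr_gt0 subr_eq0.
have -> : p u - q u - (p v - q v) = - (`|y u| - `|y v|) by rewrite /q; ring.
rewrite normrN; apply: le_trans (ye _).
by rewrite (scalarD ys) (scalarN ys) ler_dist_dist.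
Qed.
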